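(* (Preservation.) For all terms $M$ and $M'$, contexts $\Gamma$, and types $A$: if $\Gamma\vdash M:A$ and $M\leadsto M'$, then $\Gamma\vdash M':A$.
   Context: The language is a typed lambda calculus with intensional type analysis, records, lists, database tables and traces. Everything is up to renaming of bound variables; substitution is capture-avoiding. **Kinds and constructors.** $K ::= \mathit{Type} \mid \mathit{Row} \mid K_1\to K_2$. Constructors $C,D ::= \mathtt{Bool}^* \mid \mathtt{Int}^* \mid \mathtt{String}^* \mid \alpha \mid \lambda\alpha{:}K.C \mid C\,D \mid \mathtt{List}^*C \mid \mathtt{Record}^*S \mid \mathtt{Trace}^*C \mid \mathbf{Typerec}\ C\ (C_B,C_I,C_S,C_L,C_R,C_T)$. Row constructors $S ::= \cdot \mid l:C;S \mid \rho \mid \mathbf{Rmap}\ C\ S$. Type variables of kind $\mathit{Row}$ are written $\rho$; arguments of applications may also be row constructors. Kinding: variables, abstraction, application as in the simply typed lambda calculus; base constructors have kind $\mathit{Type}$; $\mathtt{List}^*C,\mathtt{Trace}^*C:\mathit{Type}$ if $C:\mathit{Type}$; $\mathtt{Record}^*S:\mathit{Type}$ if $S:\mathit{Row}$; for any kind $K$, $\mathbf{Typerec}\,C\,(C_B,C_I,C_S,C_L,C_R,C_T):K$ if $C:\mathit{Type}$, $C_B,C_I,C_S:K$, $C_L,C_T:\mathit{Type}\to K\to K$, $C_R:\mathit{Row}\to\mathit{Row}\to K$; $\cdot:\mathit{Row}$; $(l:C;S):\mathit{Row}$ if $C:\mathit{Type}$, $S:\mathit{Row}$; $\mathbf{Rmap}\,C\,S:\mathit{Row}$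 if $C:\mathit{Type}\to\mathit{Type}$, $S:\mathit{Row}$. Constructor reduction $\leadsto$ is closed under reduction in any immediate sub(row)constructor and has the rules (with $\vec C=(C_B,C_I,C_S,C_L,C_R,C_T)$): $(\lambda\alpha{:}K.C)\,D\leadsto C[\alpha:=D]$; $\mathbf{Rmap}\,C\,\cdot\leadsto\cdot$; $\mathbf{Rmap}\,C\,(l:D;S)\leadsto(l:C\,D;\mathbf{Rmap}\,C\,S)$; $\mathbf{Typerec}\,\mathtt{Bool}^*\vec C\leadsto C_B$; $\mathbf{Typerec}\,\mathtt{Int}^*\vec C\leadsto C_I$; $\mathbf{Typerec}\,\mathtt{String}^*\vec C\leadsto C_S$; $\mathbf{Typerec}\,(\mathtt{List}^*D)\,\vec C\leadsto C_L\,D\,(\mathbf{Typerec}\,D\,\vec C)$; $\mathbf{Typerec}\,(\mathtt{Record}^*S)\,\vec C\leadsto C_R\,S\,(\mathbf{Rmap}\,(\lambda\alpha.\mathbf{Typerec}\,\alpha\,\vec C)\,S)$; $\mathbf{Typerec}\,(\mathtt{Trace}^*D)\,\vec C\leadsto C_T\,D\,(\mathbf{Typerec}\,D\,\vec C)$. Constructor equivalence $\Gamma\vdash C=D:K$ (and likewise for rows) is the least congruent equivalence relation on well-kinded (row) constructors such that $C=D:K$ whenever $C:K$, $D:K$ and $C\leadsto D$, and containing $\eta$: $\lambda\alpha{:}K.C\,\alpha = C$. **Types.** $A,B ::= \mathtt{T}(C)\mid\mathtt{Bool}\mid\mathtt{Int}\mid\mathtt{String}\mid A\to B\mid\mathtt{List}\,A\mid\mathtt{Record}\,R\mid\mathtt{Trace}\,A\mid\forall\alpha{:}K.A$,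 rows $R::=\cdot\mid l:A;R\mid\mathtt{T}(S)$, with the evident kinding. Type/row equivalence $\Gamma\vdash A=B$ is the least congruent equivalence relation with $\mathtt{T}(C)=\mathtt{T}(D)$ when $C=D:\mathit{Type}$, $\mathtt{T}(S)=\mathtt{T}(S')$ when $S=S':\mathit{Row}$, and $\mathtt{T}(\mathtt{Bool}^* )=\mathtt{Bool}$, $\mathtt{T}(\mathtt{Int}^* )=\mathtt{Int}$, $\mathtt{T}(\mathtt{String}^* )=\mathtt{String}$, $\mathtt{T}(\mathtt{List}^*C)=\mathtt{List}\,\mathtt{T}(C)$, $\mathtt{T}(\mathtt{Record}^*S)=\mathtt{Record}\,\mathtt{T}(S)$, $\mathtt{T}(\mathtt{Trace}^*C)=\mathtt{Trace}\,\mathtt{T}(C)$, $\mathtt{T}(\cdot)=\cdot$, $\mathtt{T}(l:C;S)=(l:\mathtt{T}(C);\mathtt{T}(S))$. We write $[A]$ for $\mathtt{List}\,A$, $\langle R\rangle$ for $\mathtt{Record}\,R$ and often omit stars. Contexts list distinct variables $\alpha:K$ and $x:A$ with $A:\mathit{Type}$. **Terms and typing** ($\Gamma\vdash M:A$). Constants $c$ (including $\mathbf{true},\mathbf{false}$) have their base type; variables, $\lambda x{:}A.M$ (with $A:\mathit{Type}$), application as usual; $\Lambda\alpha{:}K.M:\forall\alpha{:}K.A$ if $\Gamma,\alpha:K\vdash M:A$; $M\,C:A[\alpha:=C]$ if $M:\forall\alpha{:}K.A$, $C:K$; $\mathbf{fix}\,f{:}A.M:A$ if $A$ is well-kinded and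 $\Gamma,f:A\vdash M:A$; $\mathbf{if}\ L\ \mathbf{then}\ M\ \mathbf{else}\ N:A$ if $L:\mathtt{Bool}$, $M,N:A$; $M+N:\mathtt{Int}$ if $M,N:\mathtt{Int}$; $M==N:\mathtt{Bool}$ if $M,N:A$ and $A:\mathit{Type}$; $\langle\rangle:\langle\cdot\rangle$; $\langle l=M;N\rangle:\langle l:A;R\rangle$ if $M:A$ and $N:\langle R\rangle$ (and $\langle\overline{l_i=M_i}\rangle$ abbreviates an iterated extension of $\langle\rangle$); $M.l:A$ if $M:\langle l:A;R\rangle$; $[]:[A]$ if $A:\mathit{Type}$; $[M]:[A]$ if $M:A$; $M\mathbin{+\!\!+}N:[A]$ if $M,N:[A]$; $\mathbf{for}\,(x\leftarrow M)\,N:[B]$ if $M:[A]$ and $\Gamma,x:A\vdash N:[B]$; $\mathbf{table}\ n\ \langle\mathsf{oid}:\mathtt{Int};R\rangle:[\langle\mathsf{oid}:\mathtt{Int};R\rangle]$ where $R$ is a closed row of fields of base types; conversion: $M:A$ if $M:B$ and $\Gamma\vdash A=B$. $\mathbf{rmap}^S\,M\,N:\mathtt{T}(\mathtt{Record}^*(\mathbf{Rmap}\,C\,S))$ if $M:\forall\alpha{:}\mathit{Type}.\mathtt{T}(\alpha)\to\mathtt{T}(C\,\alpha)$ and $N:\mathtt{T}(\mathtt{Record}^*S)$. $\mathbf{rfold}^S\,L\,M\,N:\mathtt{T}(C)$ if $L:\mathtt{T}(C)\to\mathtt{T}(C)\to\mathtt{T}(C)$, $M:\mathtt{T}(C)$,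 $N:\mathtt{T}(\mathtt{Record}^*(\mathbf{Rmap}\,(\lambda\alpha.C)\,S))$. $\mathbf{typecase}\ C\ \mathbf{of}\,(M_B,M_I,M_S,\beta.M_L,\rho.M_R,\gamma.M_T):B[\alpha:=C]$ if $C:\mathit{Type}$, $\Gamma,\alpha:\mathit{Type}\vdash B:\mathit{Type}$, $\beta,\rho,\gamma\notin\mathrm{Dom}(\Gamma)$, $M_B:B[\alpha:=\mathtt{Bool}^*]$, $M_I:B[\alpha:=\mathtt{Int}^*]$, $M_S:B[\alpha:=\mathtt{String}^*]$, $\Gamma,\beta:\mathit{Type}\vdash M_L:B[\alpha:=\mathtt{List}^*\beta]$, $\Gamma,\rho:\mathit{Row}\vdash M_R:B[\alpha:=\mathtt{Record}^*\rho]$, $\Gamma,\gamma:\mathit{Type}\vdash M_T:B[\alpha:=\mathtt{Trace}^*\gamma]$. With $\mathtt{TRACE}=\lambda a{:}\mathit{Type}.\mathbf{Typerec}\ a\ (\mathtt{Trace\ Bool},\mathtt{Trace\ Int},\mathtt{Trace\ String},\lambda e\,e'.\mathtt{List}\,e',\lambda r\,r'.\mathtt{Record}\,r',\lambda b\,t.t)$: $\mathtt{Lit}\,c:\mathtt{Trace}\,O$ if $c:O$, $O$ a base type ($\mathtt{Bool},\mathtt{Int},\mathtt{String}$); $\mathtt{If}\,M:\mathtt{Trace}\,A$ if $M:\langle\mathsf{cond}:\mathtt{Trace\ Bool};\mathsf{out}:\mathtt{Trace}\,A\rangle$; $\mathtt{For}\,C\,M:\mathtt{Trace}\,A$ if $C:\mathit{Type}$,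 $M:\langle\mathsf{in}:\mathtt{T}(\mathtt{TRACE}\,C);\mathsf{out}:\mathtt{Trace}\,A\rangle$; $\mathtt{Cell}\,M:\mathtt{Trace}\,A$ if $M:\langle\mathsf{tbl}:\mathtt{String};\mathsf{col}:\mathtt{String};\mathsf{row}:\mathtt{Int};\mathsf{val}:A\rangle$; $\mathtt{OpEq}\,C\,M:\mathtt{Trace\ Bool}$ if $C:\mathit{Type}$, $M:\langle\mathsf{l}:\mathtt{T}(\mathtt{TRACE}\,C);\mathsf{r}:\mathtt{T}(\mathtt{TRACE}\,C)\rangle$; $\mathtt{OpPlus}\,M:\mathtt{Trace\ Int}$ if $M:\langle\mathsf{l}:\mathtt{Trace\ Int};\mathsf{r}:\mathtt{Trace\ Int}\rangle$. $\mathbf{tracecase}\ M\ \mathbf{of}\,(x.M_L,x.M_I,\alpha.x.M_F,x.M_C,\alpha.x.M_E,x.M_P):B$ if $M:\mathtt{Trace}\,A$ and each branch has type $B$ in $\Gamma$ extended, respectively, by: $x:A$; $x:\langle\mathsf{cond}:\mathtt{Trace\ Bool};\mathsf{out}:\mathtt{Trace}\,A\rangle$; $\alpha:\mathit{Type},x:\langle\mathsf{in}:\mathtt{T}(\mathtt{TRACE}\,\alpha);\mathsf{out}:\mathtt{Trace}\,A\rangle$; $x:\langle\mathsf{tbl}:\mathtt{String};\mathsf{col}:\mathtt{String};\mathsf{row}:\mathtt{Int};\mathsf{val}:A\rangle$; $\alpha:\mathit{Type},x:\langle\mathsf{l}:\mathtt{T}(\mathtt{TRACE}\,\alpha);\mathsf{r}:\mathtt{T}(\mathtt{TRACE}\,\alpha)\rangle$;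 $x:\langle\mathsf{l}:\mathtt{Trace\ Int};\mathsf{r}:\mathtt{Trace\ Int}\rangle$. **Term reduction** $M\leadsto M'$. $\beta$-rules: $(\lambda x.M)\,N\leadsto M[x:=N]$; $\mathbf{fix}\,f.M\leadsto M[f:=\mathbf{fix}\,f.M]$; $(\Lambda\alpha.M)\,C\leadsto M[\alpha:=C]$; $\mathbf{if}\ \mathbf{true}\ \mathbf{then}\ M\ \mathbf{else}\ N\leadsto M$; $\mathbf{if}\ \mathbf{false}\ \mathbf{then}\ M\ \mathbf{else}\ N\leadsto N$; $\langle\overline{l_i=M_i}\rangle.l_i\leadsto M_i$; $\mathbf{rmap}^{(\overline{l_i:C_i})}M\,N\leadsto\langle\overline{l_i=(M\,C_i)\,N.l_i}\rangle$; $\mathbf{rfold}^{(l_1:C_1;\dots;l_n:C_n)}L\,M\,N\leadsto L\,N.l_1\,(L\,N.l_2\cdots(L\,N.l_n\,M)\cdots)$; $\mathbf{for}\,(x\leftarrow[])\,N\leadsto[]$; $\mathbf{for}\,(x\leftarrow[M])\,N\leadsto N[x:=M]$; $\mathbf{tracecase}$ applied to $\mathtt{Lit}\,M$, $\mathtt{If}\,M$, $\mathtt{For}\,C\,M$, $\mathtt{Cell}\,M$, $\mathtt{OpEq}\,C\,M$, $\mathtt{OpPlus}\,M$ reduces respectively to $M_L[x:=M]$, $M_I[x:=M]$, $M_F[\alpha:=C,x:=M]$, $M_C[x:=M]$, $M_E[\alpha:=C,x:=M]$, $M_P[x:=M]$; $\mathbf{typecase}$ on $\mathtt{Bool}^*,\mathtt{Int}^*,\mathtt{String}^*,\mathtt{List}^*C,\mathtt{Record}^*S,\mathtt{Trace}^*C$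 reduces respectively to $M_B$, $M_I$, $M_S$, $M_L[\beta:=C]$, $M_R[\rho:=S]$, $M_T[\gamma:=C]$. Commuting conversions: $(\mathbf{if}\ L\ \mathbf{then}\ M_1\ \mathbf{else}\ M_2)\,N\leadsto\mathbf{if}\ L\ \mathbf{then}\ M_1\,N\ \mathbf{else}\ M_2\,N$; the same with a constructor argument $C$ for $N$; $(\mathbf{if}\ L\ \mathbf{then}\ M\ \mathbf{else}\ N).l\leadsto\mathbf{if}\ L\ \mathbf{then}\ M.l\ \mathbf{else}\ N.l$; $\mathbf{for}\,(x\leftarrow M_1\mathbin{+\!\!+}M_2)\,N\leadsto(\mathbf{for}\,(x\leftarrow M_1)\,N)\mathbin{+\!\!+}(\mathbf{for}\,(x\leftarrow M_2)\,N)$; $\mathbf{for}\,(x\leftarrow\mathbf{for}\,(y\leftarrow L)\,M)\,N\leadsto\mathbf{for}\,(y\leftarrow L)\,\mathbf{for}\,(x\leftarrow M)\,N$; $\mathbf{if}\,(\mathbf{if}\ L\ \mathbf{then}\ M_1\ \mathbf{else}\ M_2)\ \mathbf{then}\ N_1\ \mathbf{else}\ N_2\leadsto\mathbf{if}\ L\ \mathbf{then}\,(\mathbf{if}\ M_1\ \mathbf{then}\ N_1\ \mathbf{else}\ N_2)\ \mathbf{else}\,(\mathbf{if}\ M_2\ \mathbf{then}\ N_1\ \mathbf{else}\ N_2)$; $\mathbf{for}\,(x\leftarrow\mathbf{if}\ L\ \mathbf{then}\ M_1\ \mathbf{else}\ M_2)\,N\leadsto\mathbf{if}\ L\ \mathbf{then}\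 \mathbf{for}\,(x\leftarrow M_1)\,N\ \mathbf{else}\ \mathbf{for}\,(x\leftarrow M_2)\,N$; $\mathbf{tracecase}\,(\mathbf{if}\ L\ \mathbf{then}\ M_1\ \mathbf{else}\ M_2)\ \mathbf{of}\ \vec M\leadsto\mathbf{if}\ L\ \mathbf{then}\ \mathbf{tracecase}\ M_1\ \mathbf{of}\ \vec M\ \mathbf{else}\ \mathbf{tracecase}\ M_2\ \mathbf{of}\ \vec M$. Congruence: reduction is allowed in any immediate subterm (including under binders and in case branches) of any term former except the body of $\mathbf{fix}$, and, by constructor reduction, in the (row) constructor $C$ or $S$ of $M\,C$, $\mathbf{rmap}^S$, $\mathbf{rfold}^S$, $\mathtt{For}\,C\,M$, $\mathtt{OpEq}\,C\,M$ and $\mathbf{typecase}\ C$.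
   Formalization: As printed preservation fails. Mended: M.l may select a field in any position of the row (leftmost if l repeats); the rmap rule requires distinct labels; Typerec on Record* S reduces only at result kind Type (otherwise the contractum is ill-kinded), with Typerec annotated by its kind. *)

(* Defs.v *)
(* Stdlib world *)
From Stdlib Require Import Arith List String ZArith.
Import ListNotations.

(* Bound variables are de Bruijn indices, with one index space for
   constructor variables (of every kind) and another one for term variables.
   Correspondingly, a context is a pair of a kind context and a type context
   over it: types cannot mention term variables, so the relative order of the
   two sorts of declarations is immaterial. *)

Definition label := string.

Inductive kind : Type :=
| KType
| KRow
| KArr (K1 K2 : kind).

(* Constructors and row constructors share one syntactic category and are told
   apart by their kinds, so that a constructor variable of any kind can be
   instantiated by any constructor of that kind.
   Typerec carries its result kind, just as abstractions carry the kind of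
   their variable; on well-kinded constructors it is determined by CB. *)
Inductive con : Type :=
| CBool
| CInt
| CString
| CVar (n : nat)
| CLam (K : kind) (C : con)
| CApp (C D : con)
| CList (C : con)
| CRecord (S : con)
| CTrace (C : con)
| CTyperec (K : kind) (C CB CI CS CL CR CT : con)
| CRNil
| CRCons (l : label) (C S : con)
| CRmap (C S : con).

Definition scons {X : Type} (x : X) (s : nat -> X) (n : nat) : X :=
  match n with 0 => x | S m => s m end.

Definition up_ren (r : nat -> nat) : nat -> nat :=
  scons 0 (fun n => S (r n)).

Fixpoint cren (r : nat -> nat) (C : con) : con :=
  match C with
  | CBool => CBool
  | CInt => CInt
  | CString => CString
  | CVar n => CVar (r n)
  | CLam K C => CLam K (cren (up_ren r) C)
  | CApp C D => CApp (cren r C) (cren r D)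
  | CList C => CList (cren r C)
  | CRecord R => CRecord (cren r R)
  | CTrace C => CTrace (cren r C)
  | CTyperec K C CB CI CS CL CR CT =>
      CTyperec K (cren r C) (cren r CB) (cren r CI) (cren r CS)
        (cren r CL) (cren r CR) (cren r CT)
  | CRNil => CRNil
  | CRCons l C R => CRCons l (cren r C) (cren r R)
  | CRmap C R => CRmap (cren r C) (cren r R)
  end.

Definition cshift : con -> con := cren S.

Definition up_con (s : nat -> con) : nat -> con :=
  scons (CVar 0) (fun n => cshift (s n)).

Fixpoint csubst (s : nat -> con) (C : con) : con :=
  match C with
  | CBool => CBool
  | CInt => CInt
  | CString => CString
  | CVar n => s n
  | CLam K C => CLam K (csubst (up_con s) C)
  | CApp C D => CApp (csubst s C) (csubst s D)
  | CList C => CList (csubst s C)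
  | CRecord R => CRecord (csubst s R)
  | CTrace C => CTrace (csubst s C)
  | CTyperec K C CB CI CS CL CR CT =>
      CTyperec K (csubst s C) (csubst s CB) (csubst s CI) (csubst s CS)
        (csubst s CL) (csubst s CR) (csubst s CT)
  | CRNil => CRNil
  | CRCons l C R => CRCons l (csubst s C) (csubst s R)
  | CRmap C R => CRmap (csubst s C) (csubst s R)
  end.

Definition kctx := list kind.

Inductive kinding (G : kctx) : con -> kind -> Prop :=
| k_bool : kinding G CBool KType
| k_int : kinding G CInt KType
| k_string : kinding G CString KType
| k_var n K : nth_error G n = Some K -> kinding G (CVar n) K
| k_lam K1 K2 C :
    kinding (K1 :: G) C K2 -> kinding G (CLam K1 C) (KArr K1 K2)
| k_app K1 K2 C D :
    kinding G C (KArr K1 K2) -> kinding G D K1 -> kinding G (CApp C D) K2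
| k_list C : kinding G C KType -> kinding G (CList C) KType
| k_record S : kinding G S KRow -> kinding G (CRecord S) KType
| k_trace C : kinding G C KType -> kinding G (CTrace C) KType
| k_typerec K C CB CI CS CL CR CT :
    kinding G C KType ->
    kinding G CB K -> kinding G CI K -> kinding G CS K ->
    kinding G CL (KArr KType (KArr K K)) ->
    kinding G CR (KArr KRow (KArr KRow K)) ->
    kinding G CT (KArr KType (KArr K K)) ->
    kinding G (CTyperec K C CB CI CS CL CR CT) K
| k_rnil : kinding G CRNil KRow
| k_rcons l C S :
    kinding G C KType -> kinding G S KRow -> kinding G (CRCons l C S) KRow
| k_rmap C S :
    kinding G C (KArr KType KType) -> kinding G S KRow ->
    kinding G (CRmap C S) KRow.

(* Unfolding Typerec at a record type maps the recursive call over the row.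
   Rmap only accepts functions of kind Type -> Type, so for a result kind
   K <> Type the contractum of a well-kinded constructor is ill-kinded;
   cr_typerec_record therefore applies at K = Type. *)
Inductive cred : con -> con -> Prop :=
| cr_beta K C D : cred (CApp (CLam K C) D) (csubst (scons D CVar) C)
| cr_rmap_nil C : cred (CRmap C CRNil) CRNil
| cr_rmap_cons C l D S :
    cred (CRmap C (CRCons l D S)) (CRCons l (CApp C D) (CRmap C S))
| cr_typerec_bool K CB CI CS CL CR CT :
    cred (CTyperec K CBool CB CI CS CL CR CT) CB
| cr_typerec_int K CB CI CS CL CR CT :
    cred (CTyperec K CInt CB CI CS CL CR CT) CI
| cr_typerec_string K CB CI CS CL CR CT :
    cred (CTyperec K CString CB CI CS CL CR CT) CS
| cr_typerec_list K D CB CI CS CL CR CT :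
    cred (CTyperec K (CList D) CB CI CS CL CR CT)
         (CApp (CApp CL D) (CTyperec K D CB CI CS CL CR CT))
| cr_typerec_record S CB CI CS CL CR CT :
    cred (CTyperec KType (CRecord S) CB CI CS CL CR CT)
         (CApp (CApp CR S)
            (CRmap (CLam KType
                      (CTyperec KType (CVar 0) (cshift CB) (cshift CI)
                         (cshift CS) (cshift CL) (cshift CR) (cshift CT)))
               S))
| cr_typerec_trace K D CB CI CS CL CR CT :
    cred (CTyperec K (CTrace D) CB CI CS CL CR CT)
         (CApp (CApp CT D) (CTyperec K D CB CI CS CL CR CT))
| cr_lam K C C' : cred C C' -> cred (CLam K C) (CLam K C')
| cr_app1 C C' D : cred C C' -> cred (CApp C D) (CApp C' D)
| cr_app2 C D D' : cred D D' -> cred (CApp C D) (CApp C D')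
| cr_list C C' : cred C C' -> cred (CList C) (CList C')
| cr_record S S' : cred S S' -> cred (CRecord S) (CRecord S')
| cr_trace C C' : cred C C' -> cred (CTrace C) (CTrace C')
| cr_typerec0 K C C' CB CI CS CL CR CT :
    cred C C' ->
    cred (CTyperec K C CB CI CS CL CR CT) (CTyperec K C' CB CI CS CL CR CT)
| cr_typerecB K C CB CB' CI CS CL CR CT :
    cred CB CB' ->
    cred (CTyperec K C CB CI CS CL CR CT) (CTyperec K C CB' CI CS CL CR CT)
| cr_typerecI K C CB CI CI' CS CL CR CT :
    cred CI CI' ->
    cred (CTyperec K C CB CI CS CL CR CT) (CTyperec K C CB CI' CS CL CR CT)
| cr_typerecS K C CB CI CS CS' CL CR CT :
    cred CS CS' ->
    cred (CTyperec K C CB CI CS CL CR CT) (CTyperec K C CB CI CS' CL CR CT)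
| cr_typerecL K C CB CI CS CL CL' CR CT :
    cred CL CL' ->
    cred (CTyperec K C CB CI CS CL CR CT) (CTyperec K C CB CI CS CL' CR CT)
| cr_typerecR K C CB CI CS CL CR CR' CT :
    cred CR CR' ->
    cred (CTyperec K C CB CI CS CL CR CT) (CTyperec K C CB CI CS CL CR' CT)
| cr_typerecT K C CB CI CS CL CR CT CT' :
    cred CT CT' ->
    cred (CTyperec K C CB CI CS CL CR CT) (CTyperec K C CB CI CS CL CR CT')
| cr_rcons1 l C C' S : cred C C' -> cred (CRCons l C S) (CRCons l C' S)
| cr_rcons2 l C S S' : cred S S' -> cred (CRCons l C S) (CRCons l C S')
| cr_rmap1 C C' S : cred C C' -> cred (CRmap C S) (CRmap C' S)
| cr_rmap2 C S S' : cred S S' -> cred (CRmap C S) (CRmap C S').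

Inductive ceq (G : kctx) : con -> con -> kind -> Prop :=
| ce_refl C K : kinding G C K -> ceq G C C K
| ce_sym C D K : ceq G C D K -> ceq G D C K
| ce_trans C D E K : ceq G C D K -> ceq G D E K -> ceq G C E K
| ce_red C D K : kinding G C K -> kinding G D K -> cred C D -> ceq G C D K
| ce_eta C K1 K2 :
    kinding G C (KArr K1 K2) ->
    ceq G (CLam K1 (CApp (cshift C) (CVar 0))) C (KArr K1 K2)
| ce_lam K1 K2 C D :
    ceq (K1 :: G) C D K2 -> ceq G (CLam K1 C) (CLam K1 D) (KArr K1 K2)
| ce_app K1 K2 C C' D D' :
    ceq G C C' (KArr K1 K2) -> ceq G D D' K1 ->
    ceq G (CApp C D) (CApp C' D') K2
| ce_list C D : ceq G C D KType -> ceq G (CList C) (CList D) KType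
| ce_record S S' : ceq G S S' KRow -> ceq G (CRecord S) (CRecord S') KType
| ce_trace C D : ceq G C D KType -> ceq G (CTrace C) (CTrace D) KType
| ce_typerec K C CB CI CS CL CR CT C' CB' CI' CS' CL' CR' CT' :
    ceq G C C' KType ->
    ceq G CB CB' K -> ceq G CI CI' K -> ceq G CS CS' K ->
    ceq G CL CL' (KArr KType (KArr K K)) ->
    ceq G CR CR' (KArr KRow (KArr KRow K)) ->
    ceq G CT CT' (KArr KType (KArr K K)) ->
    ceq G (CTyperec K C CB CI CS CL CR CT)
          (CTyperec K C' CB' CI' CS' CL' CR' CT') K
| ce_rcons l C C' S S' :
    ceq G C C' KType -> ceq G S S' KRow ->
    ceq G (CRCons l C S) (CRCons l C' S') KRow
| ce_rmap C C' S S' :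
    ceq G C C' (KArr KType KType) -> ceq G S S' KRow ->
    ceq G (CRmap C S) (CRmap C' S') KRow.

(* Types and type rows also share one category; the only kinds they can have
   are KType and KRow. *)
Inductive ty : Type :=
| TyT (C : con)
| TyBool
| TyInt
| TyString
| TyArr (A B : ty)
| TyList (A : ty)
| TyRecord (R : ty)
| TyTrace (A : ty)
| TyAll (K : kind) (A : ty)
| TyRNil
| TyRCons (l : label) (A R : ty).

Fixpoint tyren (r : nat -> nat) (A : ty) : ty :=
  match A with
  | TyT C => TyT (cren r C)
  | TyBool => TyBool
  | TyInt => TyInt
  | TyString => TyString
  | TyArr A B => TyArr (tyren r A) (tyren r B)
  | TyList A => TyList (tyren r A)
  | TyRecord R => TyRecord (tyren r R)
  | TyTrace A => TyTrace (tyren r A)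
  | TyAll K A => TyAll K (tyren (up_ren r) A)
  | TyRNil => TyRNil
  | TyRCons l A R => TyRCons l (tyren r A) (tyren r R)
  end.

Definition tyshift : ty -> ty := tyren S.

Fixpoint tysubst (s : nat -> con) (A : ty) : ty :=
  match A with
  | TyT C => TyT (csubst s C)
  | TyBool => TyBool
  | TyInt => TyInt
  | TyString => TyString
  | TyArr A B => TyArr (tysubst s A) (tysubst s B)
  | TyList A => TyList (tysubst s A)
  | TyRecord R => TyRecord (tysubst s R)
  | TyTrace A => TyTrace (tysubst s A)
  | TyAll K A => TyAll K (tysubst (up_con s) A)
  | TyRNil => TyRNil
  | TyRCons l A R => TyRCons l (tysubst s A) (tysubst s R)
  end.

Inductive tykind (G : kctx) : ty -> kind -> Prop :=
| tk_T C : kinding G C KType -> tykind G (TyT C) KType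
| tk_Trow S : kinding G S KRow -> tykind G (TyT S) KRow
| tk_bool : tykind G TyBool KType
| tk_int : tykind G TyInt KType
| tk_string : tykind G TyString KType
| tk_arr A B :
    tykind G A KType -> tykind G B KType -> tykind G (TyArr A B) KType
| tk_list A : tykind G A KType -> tykind G (TyList A) KType
| tk_record R : tykind G R KRow -> tykind G (TyRecord R) KType
| tk_trace A : tykind G A KType -> tykind G (TyTrace A) KType
| tk_all K A : tykind (K :: G) A KType -> tykind G (TyAll K A) KType
| tk_rnil : tykind G TyRNil KRow
| tk_rcons l A R :
    tykind G A KType -> tykind G R KRow -> tykind G (TyRCons l A R) KRow.

Inductive tyeq (G : kctx) : ty -> ty -> kind -> Prop :=
| te_refl A K : tykind G A K -> tyeq G A A K
| te_sym A B K : tyeq G A B K -> tyeq G B A K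
| te_trans A B C K : tyeq G A B K -> tyeq G B C K -> tyeq G A C K
| te_T C D : ceq G C D KType -> tyeq G (TyT C) (TyT D) KType
| te_Trow S S' : ceq G S S' KRow -> tyeq G (TyT S) (TyT S') KRow
| te_arr A A' B B' :
    tyeq G A A' KType -> tyeq G B B' KType ->
    tyeq G (TyArr A B) (TyArr A' B') KType
| te_list A A' : tyeq G A A' KType -> tyeq G (TyList A) (TyList A') KType
| te_record R R' : tyeq G R R' KRow -> tyeq G (TyRecord R) (TyRecord R') KType
| te_trace A A' : tyeq G A A' KType -> tyeq G (TyTrace A) (TyTrace A') KType
| te_all K A A' :
    tyeq (K :: G) A A' KType -> tyeq G (TyAll K A) (TyAll K A') KType
| te_rcons l A A' R R' :
    tyeq G A A' KType -> tyeq G R R' KRow ->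
    tyeq G (TyRCons l A R) (TyRCons l A' R') KRow
| te_Tbool : tyeq G (TyT CBool) TyBool KType
| te_Tint : tyeq G (TyT CInt) TyInt KType
| te_Tstring : tyeq G (TyT CString) TyString KType
| te_Tlist C :
    kinding G C KType -> tyeq G (TyT (CList C)) (TyList (TyT C)) KType
| te_Trecord S :
    kinding G S KRow -> tyeq G (TyT (CRecord S)) (TyRecord (TyT S)) KType
| te_Ttrace C :
    kinding G C KType -> tyeq G (TyT (CTrace C)) (TyTrace (TyT C)) KType
| te_Trnil : tyeq G (TyT CRNil) TyRNil KRow
| te_Trcons l C S :
    kinding G C KType -> kinding G S KRow ->
    tyeq G (TyT (CRCons l C S)) (TyRCons l (TyT C) (TyT S)) KRow.

Inductive base : Type := BBool | BInt | BString.

Definition base_ty (o : base) : ty :=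
  match o with BBool => TyBool | BInt => TyInt | BString => TyString end.

Inductive const : Type :=
| KBool (b : bool)
| KInt (z : Z)
| KString (s : string).

Definition const_base (c : const) : base :=
  match c with KBool _ => BBool | KInt _ => BInt | KString _ => BString end.

(* Binders: Lam, Fix and For bind a term variable in their last argument,
   TLam binds a constructor variable; the last three branches of Typecase bind
   one constructor variable each; every branch of Tracecase binds one term
   variable, MF and ME a constructor variable as well.
   Table n R stands for  table n <oid : Int; R>. *)
Inductive tm : Type :=
| Var (n : nat)
| Const (c : const)
| Lam (A : ty) (M : tm)
| App (M N : tm)
| TLam (K : kind) (M : tm)
| TApp (M : tm) (C : con)
| Fix (A : ty) (M : tm)
| If (L M N : tm)
| Plus (M N : tm)
| Eq (M N : tm)
| RNil
| RCons (l : label) (M N : tm)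
| Proj (M : tm) (l : label)
| Nil
| Sing (M : tm)
| Append (M N : tm)
| For (M N : tm)
| Table (n : string) (R : list (label * base))
| Rmap (S : con) (M N : tm)
| Rfold (S : con) (L M N : tm)
| Typecase (C : con) (MB MI MS ML MR MT : tm)
| TrLit (M : tm)
| TrIf (M : tm)
| TrFor (C : con) (M : tm)
| TrCell (M : tm)
| TrOpEq (C : con) (M : tm)
| TrOpPlus (M : tm)
| Tracecase (M ML MI MF MC ME MP : tm).

(* rc acts on constructor variables, rt on term variables *)
Fixpoint tren (rc rt : nat -> nat) (M : tm) : tm :=
  match M with
  | Var n => Var (rt n)
  | Const c => Const c
  | Lam A M => Lam (tyren rc A) (tren rc (up_ren rt) M)
  | App M N => App (tren rc rt M) (tren rc rt N)
  | TLam K M => TLam K (tren (up_ren rc) rt M)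
  | TApp M C => TApp (tren rc rt M) (cren rc C)
  | Fix A M => Fix (tyren rc A) (tren rc (up_ren rt) M)
  | If L M N => If (tren rc rt L) (tren rc rt M) (tren rc rt N)
  | Plus M N => Plus (tren rc rt M) (tren rc rt N)
  | Eq M N => Eq (tren rc rt M) (tren rc rt N)
  | RNil => RNil
  | RCons l M N => RCons l (tren rc rt M) (tren rc rt N)
  | Proj M l => Proj (tren rc rt M) l
  | Nil => Nil
  | Sing M => Sing (tren rc rt M)
  | Append M N => Append (tren rc rt M) (tren rc rt N)
  | For M N => For (tren rc rt M) (tren rc (up_ren rt) N)
  | Table n R => Table n R
  | Rmap R M N => Rmap (cren rc R) (tren rc rt M) (tren rc rt N)
  | Rfold R L M N =>
      Rfold (cren rc R) (tren rc rt L) (tren rc rt M) (tren rc rt N)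
  | Typecase C MB MI MS ML MR MT =>
      Typecase (cren rc C) (tren rc rt MB) (tren rc rt MI) (tren rc rt MS)
        (tren (up_ren rc) rt ML) (tren (up_ren rc) rt MR)
        (tren (up_ren rc) rt MT)
  | TrLit M => TrLit (tren rc rt M)
  | TrIf M => TrIf (tren rc rt M)
  | TrFor C M => TrFor (cren rc C) (tren rc rt M)
  | TrCell M => TrCell (tren rc rt M)
  | TrOpEq C M => TrOpEq (cren rc C) (tren rc rt M)
  | TrOpPlus M => TrOpPlus (tren rc rt M)
  | Tracecase M ML MI MF MC ME MP =>
      Tracecase (tren rc rt M)
        (tren rc (up_ren rt) ML) (tren rc (up_ren rt) MI)
        (tren (up_ren rc) (up_ren rt) MF) (tren rc (up_ren rt) MC)
        (tren (up_ren rc) (up_ren rt) ME) (tren rc (up_ren rt) MP)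
  end.

Definition id_ren (n : nat) : nat := n.

Definition up_tm (st : nat -> tm) : nat -> tm :=
  scons (Var 0) (fun n => tren id_ren S (st n)).

Definition shift_tm (st : nat -> tm) : nat -> tm :=
  fun n => tren S id_ren (st n).

Fixpoint tsubst (sc : nat -> con) (st : nat -> tm) (M : tm) : tm :=
  match M with
  | Var n => st n
  | Const c => Const c
  | Lam A M => Lam (tysubst sc A) (tsubst sc (up_tm st) M)
  | App M N => App (tsubst sc st M) (tsubst sc st N)
  | TLam K M => TLam K (tsubst (up_con sc) (shift_tm st) M)
  | TApp M C => TApp (tsubst sc st M) (csubst sc C)
  | Fix A M => Fix (tysubst sc A) (tsubst sc (up_tm st) M)
  | If L M N => If (tsubst sc st L) (tsubst sc st M) (tsubst sc st N)
  | Plus M N => Plus (tsubst sc st M) (tsubst sc st N)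
  | Eq M N => Eq (tsubst sc st M) (tsubst sc st N)
  | RNil => RNil
  | RCons l M N => RCons l (tsubst sc st M) (tsubst sc st N)
  | Proj M l => Proj (tsubst sc st M) l
  | Nil => Nil
  | Sing M => Sing (tsubst sc st M)
  | Append M N => Append (tsubst sc st M) (tsubst sc st N)
  | For M N => For (tsubst sc st M) (tsubst sc (up_tm st) N)
  | Table n R => Table n R
  | Rmap R M N => Rmap (csubst sc R) (tsubst sc st M) (tsubst sc st N)
  | Rfold R L M N =>
      Rfold (csubst sc R) (tsubst sc st L) (tsubst sc st M) (tsubst sc st N)
  | Typecase C MB MI MS ML MR MT =>
      Typecase (csubst sc C)
        (tsubst sc st MB) (tsubst sc st MI) (tsubst sc st MS)
        (tsubst (up_con sc) (shift_tm st) ML)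
        (tsubst (up_con sc) (shift_tm st) MR)
        (tsubst (up_con sc) (shift_tm st) MT)
  | TrLit M => TrLit (tsubst sc st M)
  | TrIf M => TrIf (tsubst sc st M)
  | TrFor C M => TrFor (csubst sc C) (tsubst sc st M)
  | TrCell M => TrCell (tsubst sc st M)
  | TrOpEq C M => TrOpEq (csubst sc C) (tsubst sc st M)
  | TrOpPlus M => TrOpPlus (tsubst sc st M)
  | Tracecase M ML MI MF MC ME MP =>
      Tracecase (tsubst sc st M)
        (tsubst sc (up_tm st) ML) (tsubst sc (up_tm st) MI)
        (tsubst (up_con sc) (up_tm (shift_tm st)) MF)
        (tsubst sc (up_tm st) MC)
        (tsubst (up_con sc) (up_tm (shift_tm st)) ME)
        (tsubst sc (up_tm st) MP)
  end.

Definition ty_inst (C : con) (B : ty) : ty := tysubst (scons C CVar) B.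

(* B[alpha := C] where C lives under one further constructor binder *)
Definition ty_inst_under (C : con) (B : ty) : ty :=
  tysubst (scons C (fun n => CVar (S n))) B.

Definition tm_inst (N : tm) (M : tm) : tm := tsubst CVar (scons N Var) M.

Definition tm_cinst (C : con) (M : tm) : tm := tsubst (scons C CVar) Var M.

Definition tm_inst2 (C : con) (N : tm) (M : tm) : tm :=
  tsubst (scons C CVar) (scons N Var) M.

Definition TRACE : con :=
  CLam KType
    (CTyperec KType (CVar 0) (CTrace CBool) (CTrace CInt) (CTrace CString)
       (CLam KType (CLam KType (CList (CVar 0))))
       (CLam KRow (CLam KRow (CRecord (CVar 0))))
       (CLam KType (CLam KType (CVar 0)))).

Definition row_con (fs : list (label * con)) : con :=
  fold_right (fun f S => CRCons (fst f) (snd f) S) CRNil fs.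

Definition row_ty (fs : list (label * ty)) : ty :=
  fold_right (fun f R => TyRCons (fst f) (snd f) R) TyRNil fs.

Definition base_row (fs : list (label * base)) : ty :=
  row_ty (map (fun f => (fst f, base_ty (snd f))) fs).

Definition record_tm (fs : list (label * tm)) : tm :=
  fold_right (fun f N => RCons (fst f) (snd f) N) RNil fs.

Fixpoint lookup {X : Type} (l : label) (fs : list (label * X)) : option X :=
  match fs with
  | [] => None
  | (l', x) :: fs => if String.eqb l l' then Some x else lookup l fs
  end.

(* The row R has a field l : A, not necessarily in first position. Kinding does
   not exclude repeated labels (a row variable may be instantiated by any row),
   in which case l refers to its leftmost occurrence. *)
Inductive has_field (l : label) (A : ty) : ty -> Prop :=
| hf_here R : has_field l A (TyRCons l A R)
| hf_there l' B R :
    l <> l' -> has_field l A R -> has_field l A (TyRCons l' B R).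

Definition if_row (A : ty) : ty :=
  row_ty [("cond"%string, TyTrace TyBool); ("out"%string, TyTrace A)].

Definition for_row (C : con) (A : ty) : ty :=
  row_ty [("in"%string, TyT (CApp TRACE C)); ("out"%string, TyTrace A)].

Definition cell_row (A : ty) : ty :=
  row_ty [("tbl"%string, TyString); ("col"%string, TyString);
          ("row"%string, TyInt); ("val"%string, A)].

Definition opeq_row (C : con) : ty :=
  row_ty [("l"%string, TyT (CApp TRACE C)); ("r"%string, TyT (CApp TRACE C))].

Definition opplus_row : ty :=
  row_ty [("l"%string, TyTrace TyInt); ("r"%string, TyTrace TyInt)].

Definition tctx := list ty.

Definition wf_ctx (G : kctx) (X : tctx) : Prop :=
  Forall (fun A => tykind G A KType) X.

Inductive has_type (G : kctx) (X : tctx) : tm -> ty -> Prop :=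
| t_var n A : nth_error X n = Some A -> has_type G X (Var n) A
| t_const c : has_type G X (Const c) (base_ty (const_base c))
| t_lam A B M :
    tykind G A KType -> has_type G (A :: X) M B ->
    has_type G X (Lam A M) (TyArr A B)
| t_app A B M N :
    has_type G X M (TyArr A B) -> has_type G X N A -> has_type G X (App M N) B
| t_tlam K A M :
    has_type (K :: G) (map tyshift X) M A ->
    has_type G X (TLam K M) (TyAll K A)
| t_tapp K A M C :
    has_type G X M (TyAll K A) -> kinding G C K ->
    has_type G X (TApp M C) (ty_inst C A)
| t_fix A M :
    tykind G A KType -> has_type G (A :: X) M A -> has_type G X (Fix A M) A
| t_if A L M N :
    has_type G X L TyBool -> has_type G X M A -> has_type G X N A ->
    has_type G X (If L M N) A
| t_plus M N :
    has_type G X M TyInt -> has_type G X N TyInt ->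
    has_type G X (Plus M N) TyInt
| t_eq A M N :
    tykind G A KType -> has_type G X M A -> has_type G X N A ->
    has_type G X (Eq M N) TyBool
| t_rnil : has_type G X RNil (TyRecord TyRNil)
| t_rcons l A R M N :
    has_type G X M A -> has_type G X N (TyRecord R) ->
    has_type G X (RCons l M N) (TyRecord (TyRCons l A R))
| t_proj l A R M :
    has_type G X M (TyRecord R) -> has_field l A R ->
    has_type G X (Proj M l) A
| t_nil A : tykind G A KType -> has_type G X Nil (TyList A)
| t_sing A M : has_type G X M A -> has_type G X (Sing M) (TyList A)
| t_append A M N :
    has_type G X M (TyList A) -> has_type G X N (TyList A) ->
    has_type G X (Append M N) (TyList A)
| t_for A B M N :
    has_type G X M (TyList A) -> has_type G (A :: X) N (TyList B) ->
    has_type G X (For M N) (TyList B)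
| t_table n R :
    has_type G X (Table n R)
      (TyList (TyRecord (TyRCons "oid"%string TyInt (base_row R))))
| t_rmap C S M N :
    has_type G X M
      (TyAll KType
         (TyArr (TyT (CVar 0)) (TyT (CApp (cshift C) (CVar 0))))) ->
    has_type G X N (TyT (CRecord S)) ->
    has_type G X (Rmap S M N) (TyT (CRecord (CRmap C S)))
| t_rfold C S L M N :
    has_type G X L (TyArr (TyT C) (TyArr (TyT C) (TyT C))) ->
    has_type G X M (TyT C) ->
    has_type G X N (TyT (CRecord (CRmap (CLam KType (cshift C)) S))) ->
    has_type G X (Rfold S L M N) (TyT C)
| t_typecase B C MB MI MS ML MR MT :
    kinding G C KType ->
    tykind (KType :: G) B KType ->
    has_type G X MB (ty_inst CBool B) ->
    has_type G X MI (ty_inst CInt B) ->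
    has_type G X MS (ty_inst CString B) ->
    has_type (KType :: G) (map tyshift X) ML
      (ty_inst_under (CList (CVar 0)) B) ->
    has_type (KRow :: G) (map tyshift X) MR
      (ty_inst_under (CRecord (CVar 0)) B) ->
    has_type (KType :: G) (map tyshift X) MT
      (ty_inst_under (CTrace (CVar 0)) B) ->
    has_type G X (Typecase C MB MI MS ML MR MT) (ty_inst C B)
| t_trlit c :
    has_type G X (TrLit (Const c)) (TyTrace (base_ty (const_base c)))
| t_trif A M :
    has_type G X M (TyRecord (if_row A)) -> has_type G X (TrIf M) (TyTrace A)
| t_trfor A C M :
    kinding G C KType -> has_type G X M (TyRecord (for_row C A)) ->
    has_type G X (TrFor C M) (TyTrace A)
| t_trcell A M :
    has_type G X M (TyRecord (cell_row A)) ->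
    has_type G X (TrCell M) (TyTrace A)
| t_tropeq C M :
    kinding G C KType -> has_type G X M (TyRecord (opeq_row C)) ->
    has_type G X (TrOpEq C M) (TyTrace TyBool)
| t_tropplus M :
    has_type G X M (TyRecord opplus_row) ->
    has_type G X (TrOpPlus M) (TyTrace TyInt)
| t_tracecase A B M ML MI MF MC ME MP :
    has_type G X M (TyTrace A) ->
    has_type G (A :: X) ML B ->
    has_type G (TyRecord (if_row A) :: X) MI B ->
    has_type (KType :: G)
      (TyRecord (for_row (CVar 0) (tyshift A)) :: map tyshift X)
      MF (tyshift B) ->
    has_type G (TyRecord (cell_row A) :: X) MC B ->
    has_type (KType :: G)
      (TyRecord (opeq_row (CVar 0)) :: map tyshift X)
      ME (tyshift B) ->
    has_type G (TyRecord opplus_row :: X) MP B ->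
    has_type G X (Tracecase M ML MI MF MC ME MP) B
| t_conv A B M :
    has_type G X M B -> tyeq G A B KType -> has_type G X M A.

(* s_proj selects the leftmost field labelled l, in accordance with has_field;
   for distinct labels this is the only one. The labels of a mapped row must be
   distinct: with a repeated label, a later component of the contractum would
   apply M C_i to the projection of an earlier field, of another type. *)
Inductive step : tm -> tm -> Prop :=
(* beta rules *)
| s_beta A M N : step (App (Lam A M) N) (tm_inst N M)
| s_fix A M : step (Fix A M) (tm_inst (Fix A M) M)
| s_tbeta K M C : step (TApp (TLam K M) C) (tm_cinst C M)
| s_if_true M N : step (If (Const (KBool true)) M N) M
| s_if_false M N : step (If (Const (KBool false)) M N) N
| s_proj fs l M : lookup l fs = Some M -> step (Proj (record_tm fs) l) M
| s_rmap fs M N :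
    NoDup (map fst fs) ->
    step (Rmap (row_con fs) M N)
      (record_tm
         (map (fun f => (fst f, App (TApp M (snd f)) (Proj N (fst f)))) fs))
| s_rfold fs L M N :
    step (Rfold (row_con fs) L M N)
      (fold_right (fun f P => App (App L (Proj N (fst f))) P) M fs)
| s_for_nil N : step (For Nil N) Nil
| s_for_sing M N : step (For (Sing M) N) (tm_inst M N)
| s_tracecase_lit M ML MI MF MC ME MP :
    step (Tracecase (TrLit M) ML MI MF MC ME MP) (tm_inst M ML)
| s_tracecase_if M ML MI MF MC ME MP :
    step (Tracecase (TrIf M) ML MI MF MC ME MP) (tm_inst M MI)
| s_tracecase_for C M ML MI MF MC ME MP :
    step (Tracecase (TrFor C M) ML MI MF MC ME MP) (tm_inst2 C M MF)
| s_tracecase_cell M ML MI MF MC ME MP :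
    step (Tracecase (TrCell M) ML MI MF MC ME MP) (tm_inst M MC)
| s_tracecase_opeq C M ML MI MF MC ME MP :
    step (Tracecase (TrOpEq C M) ML MI MF MC ME MP) (tm_inst2 C M ME)
| s_tracecase_opplus M ML MI MF MC ME MP :
    step (Tracecase (TrOpPlus M) ML MI MF MC ME MP) (tm_inst M MP)
| s_typecase_bool MB MI MS ML MR MT :
    step (Typecase CBool MB MI MS ML MR MT) MB
| s_typecase_int MB MI MS ML MR MT :
    step (Typecase CInt MB MI MS ML MR MT) MI
| s_typecase_string MB MI MS ML MR MT :
    step (Typecase CString MB MI MS ML MR MT) MS
| s_typecase_list C MB MI MS ML MR MT :
    step (Typecase (CList C) MB MI MS ML MR MT) (tm_cinst C ML)
| s_typecase_record S MB MI MS ML MR MT :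
    step (Typecase (CRecord S) MB MI MS ML MR MT) (tm_cinst S MR)
| s_typecase_trace C MB MI MS ML MR MT :
    step (Typecase (CTrace C) MB MI MS ML MR MT) (tm_cinst C MT)
(* commuting conversions *)
| s_app_if L M1 M2 N :
    step (App (If L M1 M2) N) (If L (App M1 N) (App M2 N))
| s_tapp_if L M1 M2 C :
    step (TApp (If L M1 M2) C) (If L (TApp M1 C) (TApp M2 C))
| s_proj_if L M N l :
    step (Proj (If L M N) l) (If L (Proj M l) (Proj N l))
| s_for_append M1 M2 N :
    step (For (Append M1 M2) N) (Append (For M1 N) (For M2 N))
| s_for_for L M N :
    step (For (For L M) N) (For L (For M (tren id_ren (up_ren S) N)))
| s_if_if L M1 M2 N1 N2 :
    step (If (If L M1 M2) N1 N2) (If L (If M1 N1 N2) (If M2 N1 N2))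
| s_for_if L M1 M2 N :
    step (For (If L M1 M2) N) (If L (For M1 N) (For M2 N))
| s_tracecase_cond L M1 M2 ML MI MF MC ME MP :
    step (Tracecase (If L M1 M2) ML MI MF MC ME MP)
      (If L (Tracecase M1 ML MI MF MC ME MP)
            (Tracecase M2 ML MI MF MC ME MP))
(* congruence *)
| s_lam A M M' : step M M' -> step (Lam A M) (Lam A M')
| s_app1 M M' N : step M M' -> step (App M N) (App M' N)
| s_app2 M N N' : step N N' -> step (App M N) (App M N')
| s_tlam K M M' : step M M' -> step (TLam K M) (TLam K M')
| s_tapp1 M M' C : step M M' -> step (TApp M C) (TApp M' C)
| s_tapp2 M C C' : cred C C' -> step (TApp M C) (TApp M C')
| s_if1 L L' M N : step L L' -> step (If L M N) (If L' M N)
| s_if2 L M M' N : step M M' -> step (If L M N) (If L M' N)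
| s_if3 L M N N' : step N N' -> step (If L M N) (If L M N')
| s_plus1 M M' N : step M M' -> step (Plus M N) (Plus M' N)
| s_plus2 M N N' : step N N' -> step (Plus M N) (Plus M N')
| s_eq1 M M' N : step M M' -> step (Eq M N) (Eq M' N)
| s_eq2 M N N' : step N N' -> step (Eq M N) (Eq M N')
| s_rcons1 l M M' N : step M M' -> step (RCons l M N) (RCons l M' N)
| s_rcons2 l M N N' : step N N' -> step (RCons l M N) (RCons l M N')
| s_proj1 M M' l : step M M' -> step (Proj M l) (Proj M' l)
| s_sing M M' : step M M' -> step (Sing M) (Sing M')
| s_append1 M M' N : step M M' -> step (Append M N) (Append M' N)
| s_append2 M N N' : step N N' -> step (Append M N) (Append M N')
| s_for1 M M' N : step M M' -> step (For M N) (For M' N)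
| s_for2 M N N' : step N N' -> step (For M N) (For M N')
| s_rmap1 S S' M N : cred S S' -> step (Rmap S M N) (Rmap S' M N)
| s_rmap2 S M M' N : step M M' -> step (Rmap S M N) (Rmap S M' N)
| s_rmap3 S M N N' : step N N' -> step (Rmap S M N) (Rmap S M N')
| s_rfold1 S S' L M N : cred S S' -> step (Rfold S L M N) (Rfold S' L M N)
| s_rfold2 S L L' M N : step L L' -> step (Rfold S L M N) (Rfold S L' M N)
| s_rfold3 S L M M' N : step M M' -> step (Rfold S L M N) (Rfold S L M' N)
| s_rfold4 S L M N N' : step N N' -> step (Rfold S L M N) (Rfold S L M N')
| s_typecase0 C C' MB MI MS ML MR MT :
    cred C C' ->
    step (Typecase C MB MI MS ML MR MT) (Typecase C' MB MI MS ML MR MT)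
| s_typecaseB C MB MB' MI MS ML MR MT :
    step MB MB' ->
    step (Typecase C MB MI MS ML MR MT) (Typecase C MB' MI MS ML MR MT)
| s_typecaseI C MB MI MI' MS ML MR MT :
    step MI MI' ->
    step (Typecase C MB MI MS ML MR MT) (Typecase C MB MI' MS ML MR MT)
| s_typecaseS C MB MI MS MS' ML MR MT :
    step MS MS' ->
    step (Typecase C MB MI MS ML MR MT) (Typecase C MB MI MS' ML MR MT)
| s_typecaseL C MB MI MS ML ML' MR MT :
    step ML ML' ->
    step (Typecase C MB MI MS ML MR MT) (Typecase C MB MI MS ML' MR MT)
| s_typecaseR C MB MI MS ML MR MR' MT :
    step MR MR' ->
    step (Typecase C MB MI MS ML MR MT) (Typecase C MB MI MS ML MR' MT)
| s_typecaseT C MB MI MS ML MR MT MT' :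
    step MT MT' ->
    step (Typecase C MB MI MS ML MR MT) (Typecase C MB MI MS ML MR MT')
| s_trlit M M' : step M M' -> step (TrLit M) (TrLit M')
| s_trif M M' : step M M' -> step (TrIf M) (TrIf M')
| s_trfor1 C C' M : cred C C' -> step (TrFor C M) (TrFor C' M)
| s_trfor2 C M M' : step M M' -> step (TrFor C M) (TrFor C M')
| s_trcell M M' : step M M' -> step (TrCell M) (TrCell M')
| s_tropeq1 C C' M : cred C C' -> step (TrOpEq C M) (TrOpEq C' M)
| s_tropeq2 C M M' : step M M' -> step (TrOpEq C M) (TrOpEq C M')
| s_tropplus M M' : step M M' -> step (TrOpPlus M) (TrOpPlus M')
| s_tracecase0 M M' ML MI MF MC ME MP :
    step M M' ->
    step (Tracecase M ML MI MF MC ME MP) (Tracecase M' ML MI MF MC ME MP)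
| s_tracecaseL M ML ML' MI MF MC ME MP :
    step ML ML' ->
    step (Tracecase M ML MI MF MC ME MP) (Tracecase M ML' MI MF MC ME MP)
| s_tracecaseI M ML MI MI' MF MC ME MP :
    step MI MI' ->
    step (Tracecase M ML MI MF MC ME MP) (Tracecase M ML MI' MF MC ME MP)
| s_tracecaseF M ML MI MF MF' MC ME MP :
    step MF MF' ->
    step (Tracecase M ML MI MF MC ME MP) (Tracecase M ML MI MF' MC ME MP)
| s_tracecaseC M ML MI MF MC MC' ME MP :
    step MC MC' ->
    step (Tracecase M ML MI MF MC ME MP) (Tracecase M ML MI MF MC' ME MP)
| s_tracecaseE M ML MI MF MC ME ME' MP :
    step ME ME' ->
    step (Tracecase M ML MI MF MC ME MP) (Tracecase M ML MI MF MC ME' MP)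
| s_tracecaseP M ML MI MF MC ME MP MP' :
    step MP MP' ->
    step (Tracecase M ML MI MF MC ME MP) (Tracecase M ML MI MF MC ME MP').

(* Main.v *)
From Stdlib Require Import List String Relation_Operators.
Require Import Defs.
Import ListNotations.

(* Preservation hinges on inverting type equality, e.g. on deriving A = B from
   List A = List B. Since such an equality may pass through T(C), this requires
   the constructors List*, Record*, Trace* and row extension to be injective and
   disjoint modulo beta-eta, Rmap and Typerec. Instead of proving confluence,
   constructors are related by a logical relation [lr]: at base kinds, equal weak
   head normal forms, hereditarily; at arrow kinds, preservation of relatedness.
   As provable equality is assumed of all arguments separately, neutral
   constructors need not be compared at all, and the relation can be defined over
   one fixed context, without quantifying over its extensions. Its fundamental
   lemma [ceq_lr] yields both normal forms and their componentwise equality. *)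

(** * Substitution and kinding of constructors *)

(** Comparing constructors of arrow kind only through their applications makes eta harmless: an eta
    step costs one weak head expansion. The price is that the relation is merely a partial
    equivalence. Its transitivity rests on weak head reduction being deterministic, and its
    reflexivity on well-kinded constructors has to be proved along with the fundamental lemma.
    [Typerec] and [Rmap] recurse over their argument; this is sound because [val] is inductive, so
    that a derivation is well-founded evidence on lists, records, traces and rows. The record case
    is the delicate one, since its unfolding mixes the two recursions. Passing from constructors to
    types meets a second obstacle: by transitivity, an equality of two list types may go through an
    arbitrary middle type, so injectivity is not provable by direct induction on the equality. It is
    replaced by a simulation, in which every head exposed by one type is matched by a head of the
    other; this property composes. *)

Lemma cren_cren (C : con) : forall r r' r'',
  (forall n, r' (r n) = r'' n) -> cren r' (cren r C) = cren r'' C.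
Proof.
  induction C; simpl; intros r r' r'' H; auto; f_equal; auto.
  apply IHC; intros [|n]; simpl; auto.
Qed.

Lemma cren_subst (C : con) : forall r s,
  (forall n, s n = CVar (r n)) -> cren r C = csubst s C.
Proof.
  induction C; simpl; intros r s H; auto; f_equal; auto.
  apply IHC; intros [|n]; simpl; auto. now rewrite H.
Qed.

Lemma csubst_id (C : con) : forall s,
  (forall n, s n = CVar n) -> csubst s C = C.
Proof.
  induction C; simpl; intros s H; auto; f_equal; auto.
  apply IHC; intros [|n]; simpl; auto. now rewrite H.
Qed.

Lemma csubst_cren (C : con) : forall r s t,
  (forall n, s (r n) = t n) -> csubst s (cren r C) = csubst t C.
Proof.
  induction C; simpl; intros r s t H; auto; f_equal; auto.
  apply IHC; intros [|n]; simpl; auto. now rewrite H.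
Qed.

Lemma cren_csubst (C : con) : forall r s t,
  (forall n, cren r (s n) = t n) -> cren r (csubst s C) = csubst t C.
Proof.
  induction C; simpl; intros r s t H; auto; f_equal; auto.
  apply IHC; intros [|n]; simpl; auto. rewrite <- H. unfold cshift.
  erewrite !cren_cren; try reflexivity.
Qed.

Lemma csubst_up_cshift (s : nat -> con) (C : con) :
  csubst (up_con s) (cshift C) = cshift (csubst s C).
Proof.
  unfold cshift. erewrite cren_csubst by reflexivity.
  apply csubst_cren; reflexivity.
Qed.

Lemma csubst_csubst (C : con) : forall s t u,
  (forall n, csubst t (s n) = u n) -> csubst t (csubst s C) = csubst u C.
Proof.
  induction C; simpl; intros s t u H; auto; f_equal; auto.
  apply IHC; intros [|n]; simpl; auto.
  rewrite csubst_up_cshift. now rewrite H.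
Qed.

Lemma csubst_scons_cshift (C D : con) : csubst (scons D CVar) (cshift C) = C.
Proof.
  unfold cshift. erewrite csubst_cren by reflexivity. now apply csubst_id.
Qed.

Lemma csubst_up_scons (s : nat -> con) (C D : con) :
  csubst (scons D CVar) (csubst (up_con s) C) = csubst (scons D s) C.
Proof.
  apply csubst_csubst. intros [|n]; simpl; auto. apply csubst_scons_cshift.
Qed.

Lemma csubst_inst (s : nat -> con) (C D : con) :
  csubst s (csubst (scons D CVar) C)
  = csubst (scons (csubst s D) CVar) (csubst (up_con s) C).
Proof.
  rewrite csubst_up_scons. apply csubst_csubst. now intros [|n].
Qed.

(** * Kinding and equality of constructors under renaming, substitution and reduction *)

Definition ren_kinded (G G' : kctx) (r : nat -> nat) : Prop :=
  forall n K, nth_error G n = Some K -> nth_error G' (r n) = Some K.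

Definition subst_kinded (G G' : kctx) (s : nat -> con) : Prop :=
  forall n K, nth_error G n = Some K -> kinding G' (s n) K.

Definition subst_ceq (G G' : kctx) (s t : nat -> con) : Prop :=
  forall n K, nth_error G n = Some K -> ceq G' (s n) (t n) K.

Lemma ren_kinded_up (G G' : kctx) (r : nat -> nat) (K : kind) :
  ren_kinded G G' r -> ren_kinded (K :: G) (K :: G') (up_ren r).
Proof. intros H [|n] K'; simpl; auto. Qed.

Lemma ren_kinded_S (G : kctx) (K : kind) : ren_kinded G (K :: G) S.
Proof. intros n K'; auto. Qed.

Lemma kinding_ren (G : kctx) (C : con) (K : kind) (H : kinding G C K) :
  forall G' r, ren_kinded G G' r -> kinding G' (cren r C) K.
Proof.
  induction H; simpl; intros G' r Hr; econstructor; eauto using ren_kinded_up.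
Qed.

Lemma kinding_cshift (G : kctx) (C : con) (K K' : kind) :
  kinding G C K -> kinding (K' :: G) (cshift C) K.
Proof. intros H. eapply kinding_ren; eauto using ren_kinded_S. Qed.

(** Strengthening. The condition on [r] runs backwards, from [G'] to [G], so that a lookup after
    renaming determines the one before. It serves to read off the kind of a constructor from its
    shift. *)
Lemma kinding_cren_inv (C : con) : forall G G' r K,
  (forall n K', nth_error G' (r n) = Some K' -> nth_error G n = Some K') ->
  kinding G' (cren r C) K -> kinding G C K.
Proof.
  induction C; simpl; intros G G' r K0 Hr H; inversion H; subst;
    econstructor; eauto.
  eapply IHC; eauto. intros [|n]; simpl; auto.
Qed.

Lemma kinding_cshift_inv (G : kctx) (C : con) (K K' : kind) :
  kinding (K' :: G) (cshift C) K -> kinding G C K.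
Proof. intros H. eapply kinding_cren_inv in H; eauto. Qed.

Lemma subst_kinded_up (G G' : kctx) (s : nat -> con) (K : kind) :
  subst_kinded G G' s -> subst_kinded (K :: G) (K :: G') (up_con s).
Proof.
  intros H [|n] K' Hn; simpl in *.
  - now constructor.
  - apply kinding_cshift; auto.
Qed.

Lemma subst_kinded_id (G : kctx) : subst_kinded G G CVar.
Proof. intros n K H. now constructor. Qed.

Lemma subst_kinded_scons (G G' : kctx) (s : nat -> con) (C : con) (K : kind) :
  kinding G' C K -> subst_kinded G G' s -> subst_kinded (K :: G) G' (scons C s).
Proof.
  intros HC Hs [|n] K' Hn; simpl in *; auto. now inversion Hn; subst.
Qed.

Lemma kinding_subst (G : kctx) (C : con) (K : kind) (H : kinding G C K) :
  forall G' s, subst_kinded G G' s -> kinding G' (csubst s C) K.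
Proof.
  induction H; simpl; intros G' s Hs;
    try (econstructor; now eauto using subst_kinded_up).
  now apply Hs.
Qed.

Lemma kinding_inst (G : kctx) (C D : con) (K K' : kind) :
  kinding (K' :: G) C K -> kinding G D K' ->
  kinding G (csubst (scons D CVar) C) K.
Proof.
  intros HC HD. eapply kinding_subst; eauto.
  apply subst_kinded_scons; auto using subst_kinded_id.
Qed.

Ltac inv_kinding :=
  repeat match goal with
  | H : kinding _ CBool _ |- _ => inversion H; clear H; subst
  | H : kinding _ (CLam _ _) _ |- _ => inversion H; clear H; subst
  | H : kinding _ (CApp _ _) _ |- _ => inversion H; clear H; subst
  | H : kinding _ (CList _) _ |- _ => inversion H; clear H; subst
  | H : kinding _ (CRecord _) _ |- _ => inversion H; clear H; subst
  | H : kinding _ (CTrace _) _ |- _ => inversion H; clear H; subst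
  | H : kinding _ (CTyperec _ _ _ _ _ _ _ _) _ |- _ =>
      inversion H; clear H; subst
  | H : kinding _ CRNil _ |- _ => inversion H; clear H; subst
  | H : kinding _ (CRCons _ _ _) _ |- _ => inversion H; clear H; subst
  | H : kinding _ (CRmap _ _) _ |- _ => inversion H; clear H; subst
  end.

(** Abstractions and [Typerec] carry their kinds, so nothing has to be guessed. Equalities obtained
    at two unrelated kinds can then be chained as soon as they share a constructor. *)
Lemma kinding_unique (G : kctx) (C : con) (K K' : kind) :
  kinding G C K -> kinding G C K' -> K = K'.
Proof.
  intros H; revert K'; induction H; intros K' H'; inversion H'; subst;
    try congruence; try (f_equal; now auto).
  match goal with
  | IH : forall _, kinding G C _ -> KArr K1 K2 = _, H : kinding G C _ |- _ =>
      specialize (IH _ H); congruence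
  end.
Qed.

Lemma kinding_cred (C D : con) (H : cred C D) :
  forall G K, kinding G C K -> kinding G D K.
Proof.
  induction H; intros G K0 HK; inv_kinding; auto;
    try (econstructor; now eauto).
  - eapply kinding_inst; eauto.
  - repeat (econstructor; eauto).
  - repeat (econstructor; eauto).
  - repeat (econstructor; eauto using kinding_cshift).
  - repeat (econstructor; eauto).
Qed.

Lemma cred_subst (C D : con) (H : cred C D) :
  forall s, cred (csubst s C) (csubst s D).
Proof.
  induction H; simpl; intros s; try (constructor; now eauto).
  - rewrite csubst_inst. constructor.
  - rewrite !csubst_up_cshift. constructor.
Qed.

Lemma ceq_kinding (G : kctx) (C D : con) (K : kind) :
  ceq G C D K -> kinding G C K /\ kinding G D K.
Proof.
  induction 1;
    repeat match goal with H : _ /\ _ |- _ => destruct H end;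
    split; auto; try (econstructor; now eauto).
  constructor. apply k_app with K1; [now apply kinding_cshift|now constructor].
Qed.

Lemma ceq_subst (G : kctx) (C D : con) (K : kind) (H : ceq G C D K) :
  forall G' s, subst_kinded G G' s -> ceq G' (csubst s C) (csubst s D) K.
Proof.
  induction H; simpl; intros G' s Hs;
    try (econstructor; now eauto using kinding_subst, subst_kinded_up).
  - apply ce_red; eauto using kinding_subst, cred_subst.
  - rewrite csubst_up_cshift. apply ce_eta.
    eapply (kinding_subst _ _ _ H); eauto.
Qed.

Lemma ceq_ren (G G' : kctx) (r : nat -> nat) (C D : con) (K : kind) :
  ren_kinded G G' r -> ceq G C D K -> ceq G' (cren r C) (cren r D) K.
Proof.
  intros Hr H. rewrite !(cren_subst _ r (fun n => CVar (r n))) by reflexivity.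
  eapply ceq_subst; eauto. intros n K' Hn. constructor. auto.
Qed.

Lemma subst_ceq_up (G G' : kctx) (s t : nat -> con) (K : kind) :
  subst_ceq G G' s t -> subst_ceq (K :: G) (K :: G') (up_con s) (up_con t).
Proof.
  intros H [|n] K' Hn; simpl in *.
  - apply ce_refl. now constructor.
  - eapply ceq_ren; eauto using ren_kinded_S.
Qed.

Lemma kinding_subst_ceq (G : kctx) (C : con) (K : kind) (H : kinding G C K) :
  forall G' s t, subst_ceq G G' s t -> ceq G' (csubst s C) (csubst t C) K.
Proof.
  induction H; simpl; intros G' s t Hs;
    try (econstructor; now eauto using subst_ceq_up);
    try (apply ce_refl; now constructor).
  now apply Hs.
Qed.

Lemma subst_ceq_kinded (G G' : kctx) (s t : nat -> con) :
  subst_ceq G G' s t -> subst_kinded G G' s /\ subst_kinded G G' t.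
Proof.
  intros H; split; intros n K Hn; specialize (H n K Hn);
    now apply ceq_kinding in H.
Qed.

Lemma ceq_subst_ceq (G G' : kctx) (s t : nat -> con) (C D : con) (K : kind) :
  ceq G C D K -> subst_ceq G G' s t -> ceq G' (csubst s C) (csubst t D) K.
Proof.
  intros H Hs. apply ce_trans with (csubst s D).
  - eapply ceq_subst; eauto. now apply (subst_ceq_kinded _ _ _ _ Hs).
  - apply ceq_kinding in H. now apply kinding_subst_ceq with G.
Qed.

(** * A logical relation over weak head reduction *)

(** Only the position that can block a redex is reduced: the function of an application, the row of
    [Rmap], the scrutinee of [Typerec]. This makes the reduction deterministic, while every root
    rule of [cred] is still included. *)
Inductive whr : con -> con -> Prop :=
| wh_beta K C D : whr (CApp (CLam K C) D) (csubst (scons D CVar) C)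
| wh_rmap_nil C : whr (CRmap C CRNil) CRNil
| wh_rmap_cons C l D S :
    whr (CRmap C (CRCons l D S)) (CRCons l (CApp C D) (CRmap C S))
| wh_typerec_bool K CB CI CS CL CR CT :
    whr (CTyperec K CBool CB CI CS CL CR CT) CB
| wh_typerec_int K CB CI CS CL CR CT :
    whr (CTyperec K CInt CB CI CS CL CR CT) CI
| wh_typerec_string K CB CI CS CL CR CT :
    whr (CTyperec K CString CB CI CS CL CR CT) CS
| wh_typerec_list K D CB CI CS CL CR CT :
    whr (CTyperec K (CList D) CB CI CS CL CR CT)
        (CApp (CApp CL D) (CTyperec K D CB CI CS CL CR CT))
| wh_typerec_record S CB CI CS CL CR CT :
    whr (CTyperec KType (CRecord S) CB CI CS CL CR CT)
        (CApp (CApp CR S)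
           (CRmap (CLam KType
                     (CTyperec KType (CVar 0) (cshift CB) (cshift CI)
                        (cshift CS) (cshift CL) (cshift CR) (cshift CT)))
              S))
| wh_typerec_trace K D CB CI CS CL CR CT :
    whr (CTyperec K (CTrace D) CB CI CS CL CR CT)
        (CApp (CApp CT D) (CTyperec K D CB CI CS CL CR CT))
| wh_app C C' D : whr C C' -> whr (CApp C D) (CApp C' D)
| wh_rmap C S S' : whr S S' -> whr (CRmap C S) (CRmap C S')
| wh_typerec K C C' CB CI CS CL CR CT :
    whr C C' ->
    whr (CTyperec K C CB CI CS CL CR CT) (CTyperec K C' CB CI CS CL CR CT).

(* Typerec over a record is stuck at a result kind other than Type, since
   cr_typerec_record does not apply there. *)
Inductive neutral : con -> Prop :=
| ne_var n : neutral (CVar n)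
| ne_app C D : neutral C -> neutral (CApp C D)
| ne_rmap C S : neutral S -> neutral (CRmap C S)
| ne_typerec K C CB CI CS CL CR CT :
    neutral C -> neutral (CTyperec K C CB CI CS CL CR CT)
| ne_typerec_record K S CB CI CS CL CR CT :
    K <> KType -> neutral (CTyperec K (CRecord S) CB CI CS CL CR CT).

Definition canonical (C : con) : Prop :=
  match C with
  | CBool | CInt | CString | CList _ | CRecord _ | CTrace _
  | CRNil | CRCons _ _ _ => True
  | _ => False
  end.

Definition whs : con -> con -> Prop := clos_refl_trans_1n con whr.

Lemma whs_refl (C : con) : whs C C.
Proof. constructor. Qed.

Lemma whs_step (C D E : con) : whr C D -> whs D E -> whs C E.
Proof. now apply rt1n_trans. Qed.

Lemma whr_neutral (C D : con) : whr C D -> ~ neutral C.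
Proof.
  induction 1; intros HN; inversion HN; subst; auto;
    match goal with
    | H : neutral _ |- _ => now inversion H
    | H : whr (CRecord _) _ |- _ => inversion H
    end.
Qed.

Lemma whr_canonical (C D : con) : whr C D -> ~ canonical C.
Proof. now destruct 1. Qed.

Lemma whr_det (C D D' : con) : whr C D -> whr C D' -> D = D'.
Proof.
  intros H; revert D'; induction H; intros D0 H0; inversion H0; subst; auto;
    try match goal with
    | H : whr ?C _ |- _ =>
        solve [exfalso; now apply (whr_canonical _ _ H) | now inversion H]
    end; f_equal; auto.
Qed.

Lemma whs_rmap (C R R' : con) : whs R R' -> whs (CRmap C R) (CRmap C R').
Proof. induction 1; eauto using whs_refl, whs_step, wh_rmap. Qed.

Lemma whs_typerec (K : kind) (C C' CB CI CS CL CR CT : con) :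
  whs C C' ->
  whs (CTyperec K C CB CI CS CL CR CT) (CTyperec K C' CB CI CS CL CR CT).
Proof. induction 1; eauto using whs_refl, whs_step, wh_typerec. Qed.

(** Neutral and canonical constructors do not reduce, so a deterministic reduction sequence can end
    in only one of them. *)
Lemma whs_unique (C D D' : con) :
  whs C D -> whs C D' -> neutral D \/ canonical D ->
  neutral D' \/ canonical D' -> D = D'.
Proof.
  intros H; induction H as [C|C E D HCE HED IH]; intros H' HD HD'.
  - destruct H' as [|E F HE]; auto.
    destruct HD; exfalso; [eapply whr_neutral|eapply whr_canonical]; eauto.
  - destruct H' as [|E' F HE' HF].
    + destruct HD'; exfalso; [eapply whr_neutral|eapply whr_canonical]; eauto.
    + rewrite (whr_det _ _ _ HCE HE') in IH. auto.
Qed.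

(* Nothing is required of neutral constructors: that related constructors are
   provably equal is always assumed separately. *)
Inductive val (G : kctx) : kind -> con -> con -> Prop :=
| v_neutral K C D C' D' :
    whs C C' -> whs D D' -> neutral C' -> neutral D' -> val G K C D
| v_bool C D : whs C CBool -> whs D CBool -> val G KType C D
| v_int C D : whs C CInt -> whs D CInt -> val G KType C D
| v_string C D : whs C CString -> whs D CString -> val G KType C D
| v_list C D C' D' :
    whs C (CList C') -> whs D (CList D') -> ceq G C' D' KType ->
    val G KType C' D' -> val G KType C D
| v_record C D R R' :
    whs C (CRecord R) -> whs D (CRecord R') -> ceq G R R' KRow ->
    val G KRow R R' -> val G KType C D
| v_trace C D C' D' :
    whs C (CTrace C') -> whs D (CTrace D') -> ceq G C' D' KType ->
    val G KType C' D' -> val G KType C D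
| v_rnil C D : whs C CRNil -> whs D CRNil -> val G KRow C D
| v_rcons C D l C' D' R R' :
    whs C (CRCons l C' R) -> whs D (CRCons l D' R') ->
    ceq G C' D' KType -> val G KType C' D' ->
    ceq G R R' KRow -> val G KRow R R' -> val G KRow C D.

(** * Closure properties of the relation *)

Lemma val_sym (G : kctx) (K : kind) (C D : con) : val G K C D -> val G K D C.
Proof.
  induction 1;
    solve [econstructor; solve [eassumption | apply ce_sym; assumption]].
Qed.

Ltac whs_determine :=
  match goal with
  | H : whs ?C ?D, H' : whs ?C ?D' |- _ =>
      assert (D = D') by
        (apply (whs_unique _ _ _ H H'); simpl; auto);
      clear H'
  end.

(** Each derivation yields a weak head normal form of the middle constructor [D], and the two
    coincide. Hence both derivations end in the same rule with the same middle components, and mixed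
    cases are contradictory. *)
Lemma val_trans (G : kctx) (K : kind) (C D E : con) :
  val G K C D -> val G K D E -> val G K C E.
Proof.
  intros H; revert E; induction H; intros E HE; inversion HE; subst;
    whs_determine; subst; try discriminate;
    try match goal with H : neutral _ |- _ => now inversion H end;
    try match goal with H : _ = _ :> con |- _ => injection H as; subst end;
    solve [econstructor; solve [eauto 3 | eapply ce_trans; eassumption]].
Qed.

Lemma val_expand (G : kctx) (K : kind) (C C' D : con) :
  whr C C' -> val G K C' D -> val G K C D.
Proof.
  intros H HV.
  destruct HV;
    solve [econstructor; solve [eassumption | eapply whs_step; eassumption]].
Qed.

(** Recursion on the kind is forced, because the relation occurs negatively at arrow kinds; [val]
    can be inductive since it recurs at base kinds only. *)
Fixpoint lr (G : kctx) (K : kind) (C D : con) : Prop :=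
  match K with
  | KArr K1 K2 =>
      forall C1 D1, ceq G C1 D1 K1 -> lr G K1 C1 D1 ->
        lr G K2 (CApp C C1) (CApp D D1)
  | _ => val G K C D
  end.

Lemma lr_sym (G : kctx) (K : kind) : forall C D, lr G K C D -> lr G K D C.
Proof. induction K; simpl; eauto using val_sym, ce_sym. Qed.

(** At an arrow kind the middle application needs an argument related to itself. Symmetry, and
    transitivity at the smaller kind, provide this for [D1] from its relation to [C1]. *)
Lemma lr_trans (G : kctx) (K : kind) :
  forall C D E, lr G K C D -> lr G K D E -> lr G K C E.
Proof.
  induction K; simpl; eauto using val_trans.
  intros C D E H H' C1 D1 Hc Hl.
  apply IHK2 with (CApp D D1); auto. apply H'.
  - apply ce_refl. now apply ceq_kinding in Hc.
  - eauto using lr_sym.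
Qed.

Lemma lr_expand (G : kctx) (K : kind) :
  forall C C' D, whr C C' -> lr G K C' D -> lr G K C D.
Proof. induction K; simpl; eauto using val_expand, wh_app. Qed.

Lemma lr_expand_whs (G : kctx) (K : kind) (C C' D D' : con) :
  whs C C' -> whs D D' -> lr G K C' D' -> lr G K C D.
Proof.
  intros HC HD H.
  assert (H' : lr G K C D') by (induction HC; eauto using lr_expand).
  clear H HC. apply lr_sym. induction HD; eauto using lr_sym, lr_expand.
Qed.

Lemma lr_expand2 (G : kctx) (K : kind) (C C' D D' : con) :
  whr C C' -> whr D D' -> lr G K C' D' -> lr G K C D.
Proof. intros HC HD. apply lr_expand_whs; eauto using whs_step, whs_refl. Qed.

(** An application with a neutral function is neutral, so arrow kinds reduce to smaller ones. In
    particular variables are related to themselves, which makes the identity substitution an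
    admissible instance of the fundamental lemma. *)
Lemma lr_neutral (G : kctx) (K : kind) :
  forall C D, neutral C -> neutral D -> lr G K C D.
Proof.
  induction K; simpl; eauto using v_neutral, whs_refl, ne_app.
Qed.

Lemma lr_app (G : kctx) (K1 K2 : kind) (C C' D D' : con) :
  lr G (KArr K1 K2) C C' -> ceq G D D' K1 -> lr G K1 D D' ->
  lr G K2 (CApp C D) (CApp C' D').
Proof. auto. Qed.

(** Recursion over the row becomes induction on the derivation of [val]: weak head reduction exposes
    one cell on each side, the mapped fields are related because [F] and [F'] are, and the mapped
    tails by the induction hypothesis. *)
Lemma lr_rmap (G : kctx) (F F' R R' : con) :
  ceq G F F' (KArr KType KType) -> lr G (KArr KType KType) F F' ->
  lr G KRow R R' -> lr G KRow (CRmap F R) (CRmap F' R').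
Proof.
  cbn [lr]. intros HF LF H. remember KRow as K eqn:EK.
  induction H; try discriminate; subst.
  - eapply v_neutral; eauto using whs_rmap, ne_rmap.
  - apply (lr_expand_whs _ KRow _ (CRmap F CRNil) _ (CRmap F' CRNil));
      auto using whs_rmap.
    apply v_rnil; eauto using whs_step, whs_refl, wh_rmap_nil.
  - apply (lr_expand_whs _ KRow _ (CRmap F (CRCons l C' R))
             _ (CRmap F' (CRCons l D' R'))); auto using whs_rmap.
    eapply v_rcons;
      eauto using whs_step, whs_refl, wh_rmap_cons, ce_app, ce_rmap.
Qed.

Lemma typerec_lam_whr (D CB CI CS CL CR CT : con) :
  whr (CApp (CLam KType
               (CTyperec KType (CVar 0) (cshift CB) (cshift CI) (cshift CS)
                  (cshift CL) (cshift CR) (cshift CT))) D)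
    (CTyperec KType D CB CI CS CL CR CT).
Proof.
  rewrite <- (csubst_scons_cshift CB D) at 2.
  rewrite <- (csubst_scons_cshift CI D) at 2.
  rewrite <- (csubst_scons_cshift CS D) at 2.
  rewrite <- (csubst_scons_cshift CL D) at 2.
  rewrite <- (csubst_scons_cshift CR D) at 2.
  rewrite <- (csubst_scons_cshift CT D) at 2.
  apply wh_beta.
Qed.

Lemma ceq_cshift (G : kctx) (C D : con) (K K' : kind) :
  ceq G C D K -> ceq (K' :: G) (cshift C) (cshift D) K.
Proof. apply ceq_ren, ren_kinded_S. Qed.

(** The recursive calls of [Typerec] are on components whose relatedness is a smaller derivation
    inside that of the scrutinee. At a record these calls are hidden in an [Rmap] over the row, so
    types and rows have to be treated in one induction. *)
Lemma lr_typerec (G : kctx) (K : kind)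
    (C D CB CI CS CL CR CT CB' CI' CS' CL' CR' CT' : con) :
  ceq G CB CB' K -> ceq G CI CI' K -> ceq G CS CS' K ->
  ceq G CL CL' (KArr KType (KArr K K)) ->
  ceq G CR CR' (KArr KRow (KArr KRow K)) ->
  ceq G CT CT' (KArr KType (KArr K K)) ->
  lr G K CB CB' -> lr G K CI CI' -> lr G K CS CS' ->
  lr G (KArr KType (KArr K K)) CL CL' ->
  lr G (KArr KRow (KArr KRow K)) CR CR' ->
  lr G (KArr KType (KArr K K)) CT CT' ->
  lr G KType C D ->
  lr G K (CTyperec K C CB CI CS CL CR CT)
    (CTyperec K D CB' CI' CS' CL' CR' CT').
Proof.
  intros EB EI ES EL ER ET LB LI LS LL LR LT H.
  (* [F] and [F'] are the functions mapped over the row when [Typerec] unfolds at a record. They are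
     well kinded only for the result kind [KType], hence the condition in [EF]. *)
  set (F := CLam KType
              (CTyperec KType (CVar 0) (cshift CB) (cshift CI) (cshift CS)
                 (cshift CL) (cshift CR) (cshift CT))).
  set (F' := CLam KType
              (CTyperec KType (CVar 0) (cshift CB') (cshift CI') (cshift CS')
                 (cshift CL') (cshift CR') (cshift CT'))).
  assert (EF : K = KType -> ceq G F F' (KArr KType KType)).
  { intros ->. apply ce_lam, ce_typerec; auto using ceq_cshift.
    apply ce_refl. now constructor. }
  (* The statement is generalised over the kind of the scrutinee: for a row it speaks of the mapped
     row instead, under the condition that makes [F] and [F'] equal. *)
  enough (P : forall K0, val G K0 C D ->
            match K0 with
            | KType =>
                lr G K (CTyperec K C CB CI CS CL CR CT)
                  (CTyperec K D CB' CI' CS' CL' CR' CT')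
            | KRow => K = KType -> val G KRow (CRmap F C) (CRmap F' D)
            | _ => True
            end) by now apply (P KType).
  clear H; intros K0 H.
  induction H as [K0 C D C' D' HC HD NC ND|C D HC HD|C D HC HD|C D HC HD
    |C D C' D' HC HD E V IH|C D R R' HC HD E V IH|C D C' D' HC HD E V IH
    |C D HC HD|C D l C' D' R R' HC HD E V IH E' V' IH'].
  - destruct K0; auto.
    + eapply lr_expand_whs; eauto using whs_typerec, lr_neutral, ne_typerec.
    + intros _. eapply v_neutral; eauto using whs_rmap, ne_rmap.
  - eapply lr_expand_whs; eauto using whs_typerec.
    eapply lr_expand2; eauto using wh_typerec_bool.
  - eapply lr_expand_whs; eauto using whs_typerec.
    eapply lr_expand2; eauto using wh_typerec_int.
  - eapply lr_expand_whs; eauto using whs_typerec.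
    eapply lr_expand2; eauto using wh_typerec_string.
  - eapply lr_expand_whs; eauto using whs_typerec.
    eapply lr_expand2; eauto using wh_typerec_list.
    apply LL; auto using ce_typerec.
  (* At the result kind [KType] both records unfold; at every other kind both sides are stuck, and
     neutral constructors are related. *)
  - assert (KD : {K = KType} + {K <> KType}) by decide equality.
    destruct KD as [->|KD].
    + eapply lr_expand_whs; eauto using whs_typerec.
      eapply lr_expand2; eauto using wh_typerec_record.
      apply LR; auto using ce_rmap.
    + eapply lr_expand_whs;
        eauto using whs_typerec, lr_neutral, ne_typerec_record.
  - eapply lr_expand_whs; eauto using whs_typerec.
    eapply lr_expand2; eauto using wh_typerec_trace.
    apply LT; auto using ce_typerec.
  - intros _.
    apply (lr_expand_whs _ KRow _ (CRmap F CRNil) _ (CRmap F' CRNil));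
      auto using whs_rmap.
    apply v_rnil; eauto using whs_step, whs_refl, wh_rmap_nil.
  - intros HK.
    apply (lr_expand_whs _ KRow _ (CRmap F (CRCons l C' R))
             _ (CRmap F' (CRCons l D' R'))); auto using whs_rmap.
    eapply v_rcons;
      eauto using whs_step, whs_refl, wh_rmap_cons, ce_app, ce_rmap.
    (* [F] applied to a field is one weak head step away from [Typerec] at that field, which the
       induction hypothesis covers. *)
    subst K. apply (lr_expand2 _ KType) with (3 := IH); apply typerec_lam_whr.
Qed.

(** * The fundamental lemma *)

Definition subst_lr (G G' : kctx) (s t : nat -> con) : Prop :=
  forall n K, nth_error G n = Some K -> lr G' K (s n) (t n).

Lemma lr_lam (G : kctx) (K1 K2 : kind) (C D : con) (s t : nat -> con) :
  (forall C1 D1, ceq G C1 D1 K1 -> lr G K1 C1 D1 ->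
     lr G K2 (csubst (scons C1 s) C) (csubst (scons D1 t) D)) ->
  lr G (KArr K1 K2) (csubst s (CLam K1 C)) (csubst t (CLam K1 D)).
Proof.
  intros H C1 D1 Hc Hl; simpl.
  eapply lr_expand2; [apply wh_beta|apply wh_beta|].
  rewrite !csubst_up_scons. auto.
Qed.

Lemma subst_ceq_scons (G G' : kctx) (s t : nat -> con) (C D : con) (K : kind) :
  ceq G' C D K -> subst_ceq G G' s t ->
  subst_ceq (K :: G) G' (scons C s) (scons D t).
Proof.
  intros HC Hs [|n] K' Hn; simpl in *; auto. now inversion Hn; subst.
Qed.

Lemma subst_lr_scons (G G' : kctx) (s t : nat -> con) (C D : con) (K : kind) :
  lr G' K C D -> subst_lr G G' s t ->
  subst_lr (K :: G) G' (scons C s) (scons D t).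
Proof.
  intros HC Hs [|n] K' Hn; simpl in *; auto. now inversion Hn; subst.
Qed.

Lemma lr_list (G : kctx) (C D : con) :
  ceq G C D KType -> lr G KType C D -> lr G KType (CList C) (CList D).
Proof. intros. eapply v_list; eauto using whs_refl. Qed.

Lemma lr_record (G : kctx) (R R' : con) :
  ceq G R R' KRow -> lr G KRow R R' -> lr G KType (CRecord R) (CRecord R').
Proof. intros. eapply v_record; eauto using whs_refl. Qed.

Lemma lr_trace (G : kctx) (C D : con) :
  ceq G C D KType -> lr G KType C D -> lr G KType (CTrace C) (CTrace D).
Proof. intros. eapply v_trace; eauto using whs_refl. Qed.

Lemma lr_rcons (G : kctx) (l : label) (C D R R' : con) :
  ceq G C D KType -> lr G KType C D -> ceq G R R' KRow -> lr G KRow R R' ->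
  lr G KRow (CRCons l C R) (CRCons l D R').
Proof. intros. eapply v_rcons; eauto using whs_refl. Qed.

(** This is reflexivity of the relation on well-kinded constructors, relaxed to two related
    substitutions so that the abstraction case goes through. The reflexivity, reduction and eta
    cases of the fundamental lemma all depend on it. *)
Lemma kinding_lr (G : kctx) (C : con) (K : kind) (H : kinding G C K) :
  forall G' s t, subst_ceq G G' s t -> subst_lr G G' s t ->
    lr G' K (csubst s C) (csubst t C).
Proof.
  induction H; intros G' s t Hs Hl; cbn [csubst].
  1-3: constructor; apply whs_refl.
  - now apply Hl.
  - apply lr_lam. eauto using subst_ceq_scons, subst_lr_scons.
  - eapply lr_app; eauto using kinding_subst_ceq.
  - apply lr_list; eauto using kinding_subst_ceq.
  - apply lr_record; eauto using kinding_subst_ceq.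
  - apply lr_trace; eauto using kinding_subst_ceq.
  - apply lr_typerec; eauto using kinding_subst_ceq.
  - constructor; apply whs_refl.
  - apply lr_rcons; eauto using kinding_subst_ceq.
  - apply lr_rmap; eauto using kinding_subst_ceq.
Qed.

Lemma whr_cred (C D : con) : whr C D -> cred C D.
Proof. induction 1; constructor; auto. Qed.

Lemma whr_subst (C D : con) (s : nat -> con) :
  whr C D -> whr (csubst s C) (csubst s D).
Proof.
  induction 1; simpl; try (constructor; now eauto).
  - rewrite csubst_inst. constructor.
  - rewrite !csubst_up_cshift. constructor.
Qed.

Lemma whr_lr (G G' : kctx) (s t : nat -> con) (C D : con) (K : kind) :
  whr C D -> kinding G C K -> subst_ceq G G' s t -> subst_lr G G' s t ->
  lr G' K (csubst s C) (csubst t D).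
Proof.
  intros H HK Hs Hl. eapply lr_expand; [exact (whr_subst _ _ s H)|].
  eapply kinding_lr; eauto using kinding_cred, whr_cred.
Qed.

(** A root redex is a weak head redex, so closure under expansion leaves only reflexivity at the
    contractum, which is well kinded again. The other rules are congruences. *)
Lemma cred_lr (C D : con) (H : cred C D) :
  forall G K, kinding G C K ->
  forall G' s t, subst_ceq G G' s t -> subst_lr G G' s t ->
    lr G' K (csubst s C) (csubst t D).
Proof.
  (* Provable equality of the two instances, which the congruence lemmas demand alongside
     relatedness. *)
  assert (E : forall G K C D G' s t, kinding G C K -> cred C D ->
            subst_ceq G G' s t -> ceq G' (csubst s C) (csubst t D) K)
    by eauto using ceq_subst_ceq, ce_red, kinding_cred.
  induction H; intros G K0 HK G' s t Hs Hl;
    try (eapply whr_lr; [now constructor|eassumption..]);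
    inv_kinding; cbn [csubst].
  1: apply lr_lam; eauto using subst_ceq_scons, subst_lr_scons.
  all: first [eapply lr_app|apply lr_list|apply lr_record|apply lr_trace
             |apply lr_typerec|apply lr_rcons|apply lr_rmap];
    eauto using kinding_subst_ceq, kinding_lr.
Qed.

Lemma ceq_lr_subst (G : kctx) (C D : con) (K : kind) (H : ceq G C D K) :
  forall G' s t, subst_ceq G G' s t -> subst_lr G G' s t ->
    lr G' K (csubst s C) (csubst t D).
Proof.
  induction H; intros G' s t Hs Hl; cbn [csubst].
  - eapply kinding_lr; eauto.
  - apply lr_sym, IHceq; intros n K' Hn; eauto using ce_sym, lr_sym.
  (* The second half is used with [t] on both sides; [t] is related to itself by symmetry and
     transitivity. *)
  - apply lr_trans with (csubst t D); auto. apply IHceq2; intros n K' Hn.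
    + apply ce_refl. now apply (subst_ceq_kinded _ _ _ _ Hs).
    + eauto using lr_sym, lr_trans.
  - eapply cred_lr; eauto.
  (* Eta: applied to [C1], the abstraction takes one beta step to the instance of [C] applied to
     [C1], and [C] is related to itself at its arrow kind. *)
  - intros C1 D1 Hc Hl1. eapply lr_expand; [apply wh_beta|].
    cbn [csubst scons up_con]. rewrite csubst_up_cshift, csubst_scons_cshift.
    eapply lr_app; eauto. eapply (kinding_lr _ _ (KArr K1 K2)); eauto.
  - apply lr_lam; eauto using subst_ceq_scons, subst_lr_scons.
  - eapply lr_app; eauto using ceq_subst_ceq.
  - apply lr_list; eauto using ceq_subst_ceq.
  - apply lr_record; eauto using ceq_subst_ceq.
  - apply lr_trace; eauto using ceq_subst_ceq.
  - apply lr_typerec; eauto using ceq_subst_ceq.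
  - apply lr_rcons; eauto using ceq_subst_ceq.
  - apply lr_rmap; eauto using ceq_subst_ceq.
Qed.

Lemma ceq_lr (G : kctx) (C D : con) (K : kind) : ceq G C D K -> lr G K C D.
Proof.
  intros H. rewrite <- (csubst_id C CVar), <- (csubst_id D CVar) by reflexivity.
  apply ceq_lr_subst with G; auto; intros n K' Hn.
  - apply ce_refl. now constructor.
  - apply lr_neutral; constructor.
Qed.

(** * Injectivity and disjointness of the canonical constructors *)

Definition canonical_ceq (G : kctx) (C D : con) : Prop :=
  match C, D with
  | CBool, CBool | CInt, CInt | CString, CString | CRNil, CRNil => True
  | CList C, CList D | CTrace C, CTrace D => ceq G C D KType
  | CRecord R, CRecord R' => ceq G R R' KRow
  | CRCons l C R, CRCons l' D R' => l = l' /\ ceq G C D KType /\ ceq G R R' KRow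
  | _, _ => False
  end.

(** A canonical constructor is its own weak head normal form. The rule of [val] that relates [C] and
    [D] is therefore dictated by their heads, and it carries the equality of their components. *)
Lemma ceq_canonical (G : kctx) (C D : con) (K : kind) :
  canonical C -> canonical D -> ceq G C D K -> canonical_ceq G C D.
Proof.
  intros HC HD H.
  (* Canonical constructors have base kinds, at which [lr] computes to [val]. *)
  assert (HV : val G K C D).
  { apply ceq_lr in H as L. apply ceq_kinding in H as [H _].
    destruct C; try contradiction; inversion H; subst; exact L. }
  assert (U : forall C C', canonical C -> whs C C' -> C = C').
  { intros ? ? HE HW. destruct HW as [|? ? HW]; auto.
    now apply whr_canonical in HW. }
  destruct HV; repeat match goal with
    | H : whs _ _ |- _ => apply U in H; auto; subst
    | H : neutral _ |- _ => now inversion H; subst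
    end; simpl; auto.
Qed.

(** * Equality of types *)

Lemma tyren_tysubst (A : ty) : forall r s,
  (forall n, s n = CVar (r n)) -> tyren r A = tysubst s A.
Proof.
  induction A; simpl; intros r s H; f_equal; auto using cren_subst.
  apply IHA; intros [|n]; simpl; auto. now rewrite H.
Qed.

Lemma tysubst_tysubst (A : ty) : forall s t u,
  (forall n, csubst t (s n) = u n) -> tysubst t (tysubst s A) = tysubst u A.
Proof.
  induction A; simpl; intros s t u H; f_equal; auto using csubst_csubst.
  apply IHA; intros [|n]; simpl; auto.
  rewrite csubst_up_cshift. now rewrite H.
Qed.

Lemma tysubst_id (A : ty) : forall s,
  (forall n, s n = CVar n) -> tysubst s A = A.
Proof.
  induction A; simpl; intros s H; f_equal; auto using csubst_id.
  apply IHA; intros [|n]; simpl; auto. now rewrite H.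
Qed.

Lemma tysubst_ext (A : ty) (s t : nat -> con) :
  (forall n, s n = t n) -> tysubst s A = tysubst t A.
Proof.
  intros H. rewrite <- (tysubst_id (tysubst s A) CVar) by reflexivity.
  apply tysubst_tysubst. intros n. now rewrite csubst_id.
Qed.

Lemma tysubst_tyren (A : ty) (r : nat -> nat) (s t : nat -> con) :
  (forall n, s (r n) = t n) -> tysubst s (tyren r A) = tysubst t A.
Proof.
  intros H. rewrite (tyren_tysubst A r (fun n => CVar (r n))) by reflexivity.
  now apply tysubst_tysubst.
Qed.

Lemma tyren_tysubst_comp (A : ty) (r : nat -> nat) (s t : nat -> con) :
  (forall n, cren r (s n) = t n) -> tyren r (tysubst s A) = tysubst t A.
Proof.
  intros H. erewrite (tyren_tysubst _ r) by reflexivity.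
  apply tysubst_tysubst. intros n. rewrite <- H. symmetry. now apply cren_subst.
Qed.

Lemma tyren_id (A : ty) : tyren id_ren A = A.
Proof. erewrite tyren_tysubst by reflexivity. now apply tysubst_id. Qed.

Lemma tysubst_up_tyshift (s : nat -> con) (A : ty) :
  tysubst (up_con s) (tyshift A) = tyshift (tysubst s A).
Proof.
  unfold tyshift. erewrite tyren_tysubst_comp by reflexivity.
  now apply tysubst_tyren.
Qed.

Lemma tysubst_scons_tyshift (s : nat -> con) (C : con) (A : ty) :
  tysubst (scons C s) (tyshift A) = tysubst s A.
Proof. now apply tysubst_tyren. Qed.

Lemma tyren_up_tyshift (r : nat -> nat) (A : ty) :
  tyren (up_ren r) (tyshift A) = tyshift (tyren r A).
Proof.
  rewrite !(tyren_tysubst A r (fun n => CVar (r n))) by reflexivity.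
  erewrite (tyren_tysubst _ (up_ren r)) by reflexivity.
  rewrite <- tysubst_up_tyshift. apply tysubst_ext. now intros [|n].
Qed.

Lemma tysubst_inst (s : nat -> con) (C : con) (B : ty) :
  tysubst s (ty_inst C B) = ty_inst (csubst s C) (tysubst (up_con s) B).
Proof.
  unfold ty_inst. erewrite !tysubst_tysubst by reflexivity.
  apply tysubst_ext. intros [|n]; simpl; auto.
  now rewrite csubst_scons_cshift.
Qed.

Lemma tysubst_inst_under (s : nat -> con) (C : con) (B : ty) :
  tysubst (up_con s) (ty_inst_under C B)
  = ty_inst_under (csubst (up_con s) C) (tysubst (up_con s) B).
Proof.
  unfold ty_inst_under. erewrite !tysubst_tysubst by reflexivity.
  apply tysubst_ext. intros [|n]; simpl; auto.
  unfold cshift. erewrite csubst_cren by reflexivity.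
  now erewrite cren_subst by reflexivity.
Qed.

Lemma ty_inst_inst_under (C D : con) (B : ty) :
  ty_inst D (ty_inst_under C B) = ty_inst (csubst (scons D CVar) C) B.
Proof.
  apply tysubst_tysubst. now intros [|n].
Qed.

Lemma tyren_inst (r : nat -> nat) (C : con) (B : ty) :
  tyren r (ty_inst C B) = ty_inst (cren r C) (tyren (up_ren r) B).
Proof.
  rewrite (tyren_tysubst _ r (fun n => CVar (r n))) by reflexivity.
  rewrite tysubst_inst. f_equal.
  - symmetry. now apply cren_subst.
  - symmetry. apply tyren_tysubst. now intros [|n].
Qed.

Lemma tyren_inst_under (r : nat -> nat) (C : con) (B : ty) :
  tyren (up_ren r) (ty_inst_under C B)
  = ty_inst_under (cren (up_ren r) C) (tyren (up_ren r) B).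
Proof.
  assert (E : forall n, up_con (fun n => CVar (r n)) n = CVar (up_ren r n))
    by now intros [|n].
  rewrite (tyren_tysubst _ _ _ E), tysubst_inst_under. f_equal.
  - symmetry. now apply cren_subst.
  - symmetry. now apply tyren_tysubst.
Qed.

Lemma tykind_subst (G : kctx) (A : ty) (K : kind) (H : tykind G A K) :
  forall G' s, subst_kinded G G' s -> tykind G' (tysubst s A) K.
Proof.
  induction H; simpl; intros G' s Hs;
    constructor; eauto using kinding_subst, subst_kinded_up.
Qed.

Lemma ren_kinded_subst (G G' : kctx) (r : nat -> nat) :
  ren_kinded G G' r -> subst_kinded G G' (fun n => CVar (r n)).
Proof. intros Hr n K Hn. constructor. auto. Qed.

Lemma tykind_ren (G G' : kctx) (r : nat -> nat) (A : ty) (K : kind) :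
  ren_kinded G G' r -> tykind G A K -> tykind G' (tyren r A) K.
Proof.
  intros Hr H. erewrite tyren_tysubst by reflexivity.
  eapply tykind_subst; eauto using ren_kinded_subst.
Qed.

Lemma tykind_tyshift (G : kctx) (A : ty) (K K' : kind) :
  tykind G A K -> tykind (K' :: G) (tyshift A) K.
Proof. apply tykind_ren, ren_kinded_S. Qed.

Lemma tykind_inst (G : kctx) (C : con) (B : ty) (K K' : kind) :
  tykind (K' :: G) B K -> kinding G C K' -> tykind G (ty_inst C B) K.
Proof.
  intros HB HC. eapply tykind_subst; eauto.
  apply subst_kinded_scons; auto using subst_kinded_id.
Qed.

Lemma tyeq_tykind (G : kctx) (A B : ty) (K : kind) :
  tyeq G A B K -> tykind G A K /\ tykind G B K.
Proof.
  induction 1;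
    repeat match goal with
    | H : _ /\ _ |- _ => destruct H
    | H : ceq _ _ _ _ |- _ => apply ceq_kinding in H
    end;
    split; repeat (constructor; auto); assumption.
Qed.

Lemma tyeq_subst (G : kctx) (A B : ty) (K : kind) (H : tyeq G A B K) :
  forall G' s, subst_kinded G G' s -> tyeq G' (tysubst s A) (tysubst s B) K.
Proof.
  induction H; simpl; intros G' s Hs;
    try (constructor;
         now eauto using kinding_subst, tykind_subst, ceq_subst, subst_kinded_up).
  eapply te_trans; eauto.
Qed.

Lemma tyeq_ren (G G' : kctx) (r : nat -> nat) (A B : ty) (K : kind) :
  ren_kinded G G' r -> tyeq G A B K -> tyeq G' (tyren r A) (tyren r B) K.
Proof.
  intros Hr H.
  rewrite !(tyren_tysubst _ r (fun n => CVar (r n))) by reflexivity.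
  eapply tyeq_subst; eauto using ren_kinded_subst.
Qed.

Lemma tykind_subst_ceq (G : kctx) (A : ty) (K : kind) (H : tykind G A K) :
  forall G' s t, subst_ceq G G' s t -> tyeq G' (tysubst s A) (tysubst t A) K.
Proof.
  induction H; simpl; intros G' s t Hs;
    try (constructor; now eauto using kinding_subst_ceq, subst_ceq_up);
    apply te_refl; constructor.
Qed.

Lemma tyeq_inst (G : kctx) (C D : con) (B : ty) (K K' : kind) :
  tykind (K' :: G) B K -> ceq G C D K' ->
  tyeq G (ty_inst C B) (ty_inst D B) K.
Proof.
  intros HB HC. eapply tykind_subst_ceq; eauto.
  apply subst_ceq_scons; auto.
  intros n K0 Hn. apply ce_refl. now constructor.
Qed.

(** * Injectivity and disjointness of type formers *)

Definition proper_ty (A : ty) : Prop :=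
  match A with TyT _ => False | _ => True end.

(* [tyhead G A V]: V is A with its head constructor pulled out of T. *)
Inductive tyhead (G : kctx) : ty -> ty -> Prop :=
| th_proper A : proper_ty A -> tyhead G A A
| th_bool C : ceq G C CBool KType -> tyhead G (TyT C) TyBool
| th_int C : ceq G C CInt KType -> tyhead G (TyT C) TyInt
| th_string C : ceq G C CString KType -> tyhead G (TyT C) TyString
| th_list C D : ceq G C (CList D) KType -> tyhead G (TyT C) (TyList (TyT D))
| th_record C R :
    ceq G C (CRecord R) KType -> tyhead G (TyT C) (TyRecord (TyT R))
| th_trace C D : ceq G C (CTrace D) KType -> tyhead G (TyT C) (TyTrace (TyT D))
| th_rnil C : ceq G C CRNil KRow -> tyhead G (TyT C) TyRNil
| th_rcons C l D R :
    ceq G C (CRCons l D R) KRow -> tyhead G (TyT C) (TyRCons l (TyT D) (TyT R)).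

Definition components_eq (G : kctx) (A B : ty) : Prop :=
  match A, B with
  | TyBool, TyBool | TyInt, TyInt | TyString, TyString | TyRNil, TyRNil => True
  | TyArr A B, TyArr A' B' => tyeq G A A' KType /\ tyeq G B B' KType
  | TyList A, TyList A' | TyTrace A, TyTrace A' => tyeq G A A' KType
  | TyRecord R, TyRecord R' => tyeq G R R' KRow
  | TyAll K A, TyAll K' A' => K = K' /\ tyeq (K :: G) A A' KType
  | TyRCons l A R, TyRCons l' A' R' =>
      l = l' /\ tyeq G A A' KType /\ tyeq G R R' KRow
  | _, _ => False
  end.

Lemma components_eq_refl (G : kctx) (A : ty) (K : kind) :
  proper_ty A -> tykind G A K -> components_eq G A A.
Proof. intros HA H. destruct H; simpl in *; auto using te_refl. Qed.

Lemma components_eq_trans (G : kctx) (A B C : ty) :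
  components_eq G A B -> components_eq G B C -> components_eq G A C.
Proof.
  destruct A, B; simpl; try tauto; destruct C; simpl; try tauto;
    eauto using te_trans.
  - intros [] []; eauto using te_trans.
  - intros [<- ?] [<- ?]; eauto using te_trans.
  - intros [<- []] [<- []]; eauto using te_trans.
Qed.

Lemma tyhead_refl (G : kctx) (A V : ty) (K : kind) :
  tyhead G A V -> tykind G A K -> components_eq G V V.
Proof.
  intros HV HA.
  destruct HV;
    try match goal with
    | H : ceq _ _ _ _ |- _ =>
        apply ceq_kinding in H as [_ H]; inversion H; subst
    end; simpl; auto using te_refl, tk_T, tk_Trow.
  eapply components_eq_refl; eauto.
Qed.

(** Quantifying over all heads of [A] makes the property compose along transitivity, whatever the
    middle type is. It holds vacuously when [A] exposes no head, as for [TyT] of a variable. *)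
Definition head_sim (G : kctx) (A B : ty) : Prop :=
  forall V, tyhead G A V -> exists W, tyhead G B W /\ components_eq G V W.

Lemma head_sim_T (G : kctx) (C D : con) (K : kind) :
  ceq G C D K -> head_sim G (TyT C) (TyT D).
Proof.
  intros H V HV. exists V.
  assert (E : forall E K', ceq G C E K' -> ceq G D E K').
  { intros E K' H'. apply ce_trans with C; auto. apply ce_sym.
    replace K' with K; auto.
    apply ceq_kinding in H as [H _], H' as [H' _]. eauto using kinding_unique. }
  inversion HV; subst; [contradiction|..]; (split; [constructor; now apply E|]).
  all: match goal with H : ceq _ _ _ _ |- _ =>
         apply ceq_kinding in H as [_ H]; inversion H; subst
       end; simpl; auto using te_refl, tk_T, tk_Trow.
Qed.

(** Two heads of [TyT C] stem from two canonical constructors equal to [C], which [ceq_canonical]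
    compares. Here the logical relation enters the theory of types. *)
Lemma tyhead_unique (G : kctx) (A V W : ty) (K : kind) :
  tykind G A K -> tyhead G A V -> tyhead G A W -> components_eq G V W.
Proof.
  intros HA HV HW.
  assert (E : forall C D D' K K', ceq G C D K -> ceq G C D' K' ->
            canonical D -> canonical D' -> canonical_ceq G D D').
  { intros C D D' K1 K2 H H' HD HD'. apply ceq_canonical with K1; auto.
    apply ce_trans with C; auto using ce_sym.
    replace K1 with K2; auto.
    apply ceq_kinding in H as [H _], H' as [H' _]. eauto using kinding_unique. }
  destruct HV; inversion HW; subst; try contradiction;
    try (eapply components_eq_refl; eassumption);
    match goal with
    | H : ceq _ ?C _ _, H' : ceq _ ?C _ _ |- _ =>
        specialize (E _ _ _ _ _ H H' I I); simpl in E
    end; try contradiction; simpl; auto using te_T, te_Trow.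
  destruct E as (? & ? & ?); auto using te_T, te_Trow.
Qed.

Lemma head_sim_proper (G : kctx) (A B : ty) :
  proper_ty A -> proper_ty B -> components_eq G A B -> head_sim G A B.
Proof.
  intros HA HB E V HV. inversion HV; subst; try contradiction.
  eauto using th_proper.
Qed.

(** Serves the equations that move [T] inside a former: their right-hand side is a head of their
    left-hand side. *)
Lemma head_sim_head (G : kctx) (A V : ty) (K : kind) :
  tykind G A K -> proper_ty V -> tyhead G A V ->
  head_sim G A V /\ head_sim G V A.
Proof.
  intros HA PV HV. split; intros W HW.
  - exists V. eauto using th_proper, tyhead_unique.
  - exists V. inversion HW; subst; try contradiction.
    eauto using tyhead_refl.
Qed.

(** Both directions are proved together, since the symmetry rule exchanges them. *)
Lemma tyeq_head_sim (G : kctx) (A B : ty) (K : kind) :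
  tyeq G A B K -> head_sim G A B /\ head_sim G B A.
Proof.
  induction 1;
    try (split; apply head_sim_proper; simpl; now auto using te_sym);
    try first
      [apply (head_sim_head _ _ _ KType);
       solve [exact I | constructor; now constructor
             | constructor; apply ce_refl; now constructor]
      |apply (head_sim_head _ _ _ KRow);
       solve [exact I | constructor; now constructor
             | constructor; apply ce_refl; now constructor]].
  - split; intros V HV; exists V; eauto using tyhead_refl.
  - tauto.
  - destruct IHtyeq1 as [I1 J1], IHtyeq2 as [I2 J2]. split; intros V HV.
    + apply I1 in HV as (W & HW & E). apply I2 in HW as (U & HU & E').
      eauto using components_eq_trans.
    + apply J2 in HV as (W & HW & E). apply J1 in HW as (U & HU & E').
      eauto using components_eq_trans.
  - split; eapply head_sim_T; eauto using ce_sym.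
  - split; eapply head_sim_T; eauto using ce_sym.
Qed.

(** A proper type is its own head and has no other, so the simulation relates [A] and [B]
    themselves. *)
Lemma tyeq_components (G : kctx) (A B : ty) (K : kind) :
  proper_ty A -> proper_ty B -> tyeq G A B K -> components_eq G A B.
Proof.
  intros HA HB H. apply tyeq_head_sim in H as [H _].
  destruct (H A) as (W & HW & E); [now constructor|].
  inversion HW; subst; try contradiction. exact E.
Qed.

Lemma has_field_tykind (G : kctx) (l : label) (A R : ty) :
  has_field l A R -> tykind G R KRow -> tykind G A KType.
Proof. induction 1; intros HR; inversion HR; subst; auto. Qed.

Lemma has_field_tysubst (s : nat -> con) (l : label) (A R : ty) :
  has_field l A R -> has_field l (tysubst s A) (tysubst s R).
Proof. induction 1; simpl; constructor; auto. Qed.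

Lemma has_field_tyren (r : nat -> nat) (l : label) (A R : ty) :
  has_field l A R -> has_field l (tyren r A) (tyren r R).
Proof. induction 1; simpl; constructor; auto. Qed.

(** * Substitution and regularity of typing *)

Lemma base_row_tyren (r : nat -> nat) (fs : list (label * base)) :
  tyren r (base_row fs) = base_row fs.
Proof.
  unfold base_row.
  induction fs as [|[l []] fs IH]; simpl in *; now rewrite ?IH.
Qed.

Lemma base_row_tysubst (s : nat -> con) (fs : list (label * base)) :
  tysubst s (base_row fs) = base_row fs.
Proof.
  unfold base_row.
  induction fs as [|[l []] fs IH]; simpl in *; now rewrite ?IH.
Qed.

Lemma tykind_base_row (G : kctx) (fs : list (label * base)) :
  tykind G (base_row fs) KRow.
Proof.
  unfold base_row.
  induction fs as [|[l []] fs IH]; simpl in *; repeat constructor; auto.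
Qed.

Lemma tyren_base (r : nat -> nat) (o : base) : tyren r (base_ty o) = base_ty o.
Proof. now destruct o. Qed.

Lemma tysubst_base (s : nat -> con) (o : base) :
  tysubst s (base_ty o) = base_ty o.
Proof. now destruct o. Qed.

Lemma cren_up_cshift (r : nat -> nat) (C : con) :
  cren (up_ren r) (cshift C) = cshift (cren r C).
Proof. unfold cshift. now erewrite !cren_cren by reflexivity. Qed.

Definition ctx_ren (X X' : tctx) (rc rt : nat -> nat) : Prop :=
  forall n A, nth_error X n = Some A -> nth_error X' (rt n) = Some (tyren rc A).

Lemma ctx_ren_cons (X X' : tctx) (rc rt : nat -> nat) (A : ty) :
  ctx_ren X X' rc rt -> ctx_ren (A :: X) (tyren rc A :: X') rc (up_ren rt).
Proof. intros H [|n] B Hn; simpl in *; auto. now inversion Hn; subst. Qed.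

Lemma nth_error_map_inv {T U : Type} (f : T -> U) (l : list T) (n : nat)
    (y : U) :
  nth_error (map f l) n = Some y -> exists x, nth_error l n = Some x /\ y = f x.
Proof.
  rewrite nth_error_map.
  destruct (nth_error l n); simpl; intros H; inversion H; eauto.
Qed.

Lemma ctx_ren_tyshift (X X' : tctx) (rc rt : nat -> nat) :
  ctx_ren X X' rc rt ->
  ctx_ren (map tyshift X) (map tyshift X') (up_ren rc) rt.
Proof.
  intros H n A Hn. apply nth_error_map_inv in Hn as (B & Hn & ->).
  rewrite tyren_up_tyshift. apply map_nth_error. auto.
Qed.

Lemma has_type_ren (G : kctx) (X : tctx) (M : tm) (A : ty)
    (H : has_type G X M A) :
  forall G' X' rc rt, ren_kinded G G' rc -> ctx_ren X X' rc rt ->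
    has_type G' X' (tren rc rt M) (tyren rc A).
Proof.
  induction H; intros G' X' rc rt Hc Ht; cbn [tren tyren].
  - constructor. auto.
  - rewrite tyren_base. constructor.
  - constructor; eauto using tykind_ren, ctx_ren_cons.
  - econstructor; [apply IHhas_type1|apply IHhas_type2]; auto.
  - constructor. eauto using ren_kinded_up, ctx_ren_tyshift.
  - rewrite tyren_inst.
    econstructor; [now apply IHhas_type|eauto using kinding_ren].
  - constructor; eauto using tykind_ren, ctx_ren_cons.
  - constructor; [apply IHhas_type1|apply IHhas_type2|apply IHhas_type3]; auto.
  - constructor; [apply IHhas_type1|apply IHhas_type2]; auto.
  - econstructor; eauto using tykind_ren.
  - constructor.
  - constructor; [apply IHhas_type1|apply IHhas_type2]; auto.
  - econstructor; [now apply IHhas_type|now apply has_field_tyren].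
  - constructor; eauto using tykind_ren.
  - constructor; auto.
  - constructor; [apply IHhas_type1|apply IHhas_type2]; auto.
  - econstructor; [now apply IHhas_type1|apply IHhas_type2; auto using ctx_ren_cons].
  - rewrite base_row_tyren. constructor.
  - constructor; [|now apply IHhas_type2].
    rewrite <- cren_up_cshift. now apply IHhas_type1.
  - constructor; [now apply IHhas_type1|now apply IHhas_type2|].
    rewrite <- cren_up_cshift. now apply IHhas_type3.
  - specialize (IHhas_type1 _ _ _ _ Hc Ht).
    specialize (IHhas_type2 _ _ _ _ Hc Ht).
    specialize (IHhas_type3 _ _ _ _ Hc Ht).
    specialize (IHhas_type4 _ _ _ _ (ren_kinded_up _ _ _ KType Hc)
                  (ctx_ren_tyshift _ _ _ _ Ht)).
    specialize (IHhas_type5 _ _ _ _ (ren_kinded_up _ _ _ KRow Hc)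
                  (ctx_ren_tyshift _ _ _ _ Ht)).
    specialize (IHhas_type6 _ _ _ _ (ren_kinded_up _ _ _ KType Hc)
                  (ctx_ren_tyshift _ _ _ _ Ht)).
    rewrite tyren_inst in IHhas_type1, IHhas_type2, IHhas_type3 |- *.
    rewrite tyren_inst_under in IHhas_type4, IHhas_type5, IHhas_type6.
    constructor; eauto using kinding_ren, tykind_ren, ren_kinded_up.
  - rewrite tyren_base. constructor.
  - constructor. now apply IHhas_type.
  - constructor; [eauto using kinding_ren|now apply IHhas_type].
  - constructor. now apply IHhas_type.
  - constructor; [eauto using kinding_ren|now apply IHhas_type].
  - constructor. now apply IHhas_type.
  - specialize (IHhas_type4 _ _ _ _ (ren_kinded_up _ _ _ KType Hc)
                  (ctx_ren_cons _ _ _ _ (TyRecord (for_row (CVar 0) (tyshift A)))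
                     (ctx_ren_tyshift _ _ _ _ Ht))).
    specialize (IHhas_type6 _ _ _ _ (ren_kinded_up _ _ _ KType Hc)
                  (ctx_ren_cons _ _ _ _ (TyRecord (opeq_row (CVar 0)))
                     (ctx_ren_tyshift _ _ _ _ Ht))).
    rewrite tyren_up_tyshift in IHhas_type4, IHhas_type6.
    cbn in IHhas_type4. rewrite tyren_up_tyshift in IHhas_type4.
    eapply t_tracecase; [now apply IHhas_type1|now apply IHhas_type2, ctx_ren_cons
      |now apply IHhas_type3, (ctx_ren_cons _ _ _ _ (TyRecord (if_row A)))
      |exact IHhas_type4
      |now apply IHhas_type5, (ctx_ren_cons _ _ _ _ (TyRecord (cell_row A)))
      |exact IHhas_type6
      |now apply IHhas_type7, (ctx_ren_cons _ _ _ _ (TyRecord opplus_row))].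
  - eapply t_conv; [now apply IHhas_type|eauto using tyeq_ren].
Qed.

Definition ctx_subst (G' : kctx) (X X' : tctx) (sc : nat -> con)
    (st : nat -> tm) : Prop :=
  forall n A, nth_error X n = Some A -> has_type G' X' (st n) (tysubst sc A).

Lemma ctx_subst_cons (G' : kctx) (X X' : tctx) (sc : nat -> con)
    (st : nat -> tm) (A : ty) :
  ctx_subst G' X X' sc st ->
  ctx_subst G' (A :: X) (tysubst sc A :: X') sc (up_tm st).
Proof.
  intros H [|n] B Hn; simpl in *.
  - inversion Hn; subst. now constructor.
  - rewrite <- (tyren_id (tysubst sc B)). eapply has_type_ren; eauto.
    + intros m K Hm. exact Hm.
    + intros m C Hm. now rewrite tyren_id.
Qed.

Lemma ctx_subst_tyshift (G' : kctx) (X X' : tctx) (sc : nat -> con)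
    (st : nat -> tm) (K : kind) :
  ctx_subst G' X X' sc st ->
  ctx_subst (K :: G') (map tyshift X) (map tyshift X') (up_con sc) (shift_tm st).
Proof.
  intros H n A Hn. apply nth_error_map_inv in Hn as (B & Hn & ->).
  rewrite tysubst_up_tyshift. eapply has_type_ren; eauto using ren_kinded_S.
  intros m C Hm. now apply map_nth_error.
Qed.

Lemma has_type_subst (G : kctx) (X : tctx) (M : tm) (A : ty)
    (H : has_type G X M A) :
  forall G' X' sc st, subst_kinded G G' sc -> ctx_subst G' X X' sc st ->
    has_type G' X' (tsubst sc st M) (tysubst sc A).
Proof.
  induction H; intros G' X' rc rt Hc Ht; cbn [tsubst tysubst].
  - auto.
  - rewrite tysubst_base. constructor.
  - constructor; eauto using tykind_subst, ctx_subst_cons.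
  - econstructor; [apply IHhas_type1|apply IHhas_type2]; auto.
  - constructor. eauto using subst_kinded_up, ctx_subst_tyshift.
  - rewrite tysubst_inst.
    econstructor; [now apply IHhas_type|eauto using kinding_subst].
  - constructor; eauto using tykind_subst, ctx_subst_cons.
  - constructor; [apply IHhas_type1|apply IHhas_type2|apply IHhas_type3]; auto.
  - constructor; [apply IHhas_type1|apply IHhas_type2]; auto.
  - econstructor; eauto using tykind_subst.
  - constructor.
  - constructor; [apply IHhas_type1|apply IHhas_type2]; auto.
  - econstructor; [now apply IHhas_type|now apply has_field_tysubst].
  - constructor; eauto using tykind_subst.
  - constructor; auto.
  - constructor; [apply IHhas_type1|apply IHhas_type2]; auto.
  - econstructor; [now apply IHhas_type1|apply IHhas_type2; auto using ctx_subst_cons].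
  - rewrite base_row_tysubst. constructor.
  - constructor; [|now apply IHhas_type2].
    rewrite <- csubst_up_cshift. now apply IHhas_type1.
  - constructor; [now apply IHhas_type1|now apply IHhas_type2|].
    rewrite <- csubst_up_cshift. now apply IHhas_type3.
  - specialize (IHhas_type1 _ _ _ _ Hc Ht).
    specialize (IHhas_type2 _ _ _ _ Hc Ht).
    specialize (IHhas_type3 _ _ _ _ Hc Ht).
    specialize (IHhas_type4 _ _ _ _ (subst_kinded_up _ _ _ KType Hc)
                  (ctx_subst_tyshift _ _ _ _ _ KType Ht)).
    specialize (IHhas_type5 _ _ _ _ (subst_kinded_up _ _ _ KRow Hc)
                  (ctx_subst_tyshift _ _ _ _ _ KRow Ht)).
    specialize (IHhas_type6 _ _ _ _ (subst_kinded_up _ _ _ KType Hc)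
                  (ctx_subst_tyshift _ _ _ _ _ KType Ht)).
    rewrite tysubst_inst in IHhas_type1, IHhas_type2, IHhas_type3 |- *.
    rewrite tysubst_inst_under in IHhas_type4, IHhas_type5, IHhas_type6.
    constructor; eauto using kinding_subst, tykind_subst, subst_kinded_up.
  - rewrite tysubst_base. constructor.
  - constructor. now apply IHhas_type.
  - constructor; [eauto using kinding_subst|now apply IHhas_type].
  - constructor. now apply IHhas_type.
  - constructor; [eauto using kinding_subst|now apply IHhas_type].
  - constructor. now apply IHhas_type.
  - specialize (IHhas_type4 _ _ _ _ (subst_kinded_up _ _ _ KType Hc)
                  (ctx_subst_cons _ _ _ _ _ (TyRecord (for_row (CVar 0) (tyshift A)))
                     (ctx_subst_tyshift _ _ _ _ _ KType Ht))).
    specialize (IHhas_type6 _ _ _ _ (subst_kinded_up _ _ _ KType Hc)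
                  (ctx_subst_cons _ _ _ _ _ (TyRecord (opeq_row (CVar 0)))
                     (ctx_subst_tyshift _ _ _ _ _ KType Ht))).
    rewrite tysubst_up_tyshift in IHhas_type4, IHhas_type6.
    cbn in IHhas_type4. rewrite tysubst_up_tyshift in IHhas_type4.
    eapply t_tracecase; [now apply IHhas_type1|now apply IHhas_type2, ctx_subst_cons
      |now apply IHhas_type3, (ctx_subst_cons _ _ _ _ _ (TyRecord (if_row A)))
      |exact IHhas_type4
      |now apply IHhas_type5, (ctx_subst_cons _ _ _ _ _ (TyRecord (cell_row A)))
      |exact IHhas_type6
      |now apply IHhas_type7, (ctx_subst_cons _ _ _ _ _ (TyRecord opplus_row))].
  - eapply t_conv; [now apply IHhas_type|eauto using tyeq_subst].
Qed.

Lemma ctx_subst_id (G : kctx) (X : tctx) : ctx_subst G X X CVar Var.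
Proof. intros n A Hn. rewrite tysubst_id by reflexivity. now constructor. Qed.

Lemma has_type_inst (G : kctx) (X : tctx) (M N : tm) (A B : ty) :
  has_type G (A :: X) M B -> has_type G X N A -> has_type G X (tm_inst N M) B.
Proof.
  intros HM HN. rewrite <- (tysubst_id B CVar) by reflexivity.
  eapply has_type_subst; eauto using subst_kinded_id.
  intros [|n] C Hn; simpl in Hn.
  - inversion Hn; subst. now rewrite tysubst_id by reflexivity.
  - now apply ctx_subst_id.
Qed.

Lemma ctx_subst_scons_tyshift (G : kctx) (X : tctx) (C : con) :
  ctx_subst G (map tyshift X) X (scons C CVar) Var.
Proof.
  intros n A Hn. apply nth_error_map_inv in Hn as (B & Hn & ->).
  rewrite tysubst_scons_tyshift. now apply ctx_subst_id.
Qed.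

Lemma has_type_cinst (G : kctx) (X : tctx) (M : tm) (B : ty) (C : con)
    (K : kind) :
  has_type (K :: G) (map tyshift X) M B -> kinding G C K ->
  has_type G X (tm_cinst C M) (ty_inst C B).
Proof.
  intros HM HC. eapply has_type_subst; eauto using ctx_subst_scons_tyshift.
  apply subst_kinded_scons; auto using subst_kinded_id.
Qed.

(** The type of the branch is a weakening, because the constructor hidden in a trace must not escape
    into the result; instantiating the variable by [C] then restores [B]. *)
Lemma has_type_inst2 (G : kctx) (X : tctx) (M N : tm) (A B : ty) (C : con)
    (K : kind) :
  has_type (K :: G) (A :: map tyshift X) M (tyshift B) -> kinding G C K ->
  has_type G X N (ty_inst C A) -> has_type G X (tm_inst2 C N M) B.
Proof.
  intros HM HC HN. rewrite <- (tysubst_id B CVar) by reflexivity.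
  rewrite <- (tysubst_scons_tyshift CVar C B).
  eapply has_type_subst; eauto.
  - apply subst_kinded_scons; auto using subst_kinded_id.
  - intros [|n] D Hn; simpl in Hn.
    + now inversion Hn; subst.
    + now apply ctx_subst_scons_tyshift.
Qed.

(** * Regularity: types of terms are well kinded *)

Lemma wf_ctx_tyshift (G : kctx) (X : tctx) (K : kind) :
  wf_ctx G X -> wf_ctx (K :: G) (map tyshift X).
Proof.
  intros H. apply Forall_map. eapply Forall_impl; [|exact H].
  intros A. apply tykind_tyshift.
Qed.

Lemma wf_ctx_cons (G : kctx) (X : tctx) (A : ty) :
  tykind G A KType -> wf_ctx G X -> wf_ctx G (A :: X).
Proof. now constructor. Qed.

Lemma kinding_TRACE (G : kctx) : kinding G TRACE (KArr KType KType).
Proof. repeat econstructor. Qed.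

Lemma tykind_if_row (G : kctx) (A : ty) :
  tykind G A KType -> tykind G (TyRecord (if_row A)) KType.
Proof. repeat constructor; auto. Qed.

Lemma tykind_for_row (G : kctx) (C : con) (A : ty) :
  kinding G C KType -> tykind G A KType ->
  tykind G (TyRecord (for_row C A)) KType.
Proof. repeat constructor; eauto using k_app, kinding_TRACE. Qed.

Lemma tykind_cell_row (G : kctx) (A : ty) :
  tykind G A KType -> tykind G (TyRecord (cell_row A)) KType.
Proof. repeat constructor; auto. Qed.

Lemma tykind_opeq_row (G : kctx) (C : con) :
  kinding G C KType -> tykind G (TyRecord (opeq_row C)) KType.
Proof. repeat constructor; eauto using k_app, kinding_TRACE. Qed.

Lemma tykind_opplus_row (G : kctx) : tykind G (TyRecord opplus_row) KType.
Proof. repeat constructor. Qed.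

Lemma tykind_base (G : kctx) (o : base) : tykind G (base_ty o) KType.
Proof. destruct o; constructor. Qed.

Ltac inv_tykind :=
  repeat match goal with
  | H : tykind _ (TyArr _ _) _ |- _ => inversion H; clear H; subst
  | H : tykind _ (TyList _) _ |- _ => inversion H; clear H; subst
  | H : tykind _ (TyRecord _) _ |- _ => inversion H; clear H; subst
  | H : tykind _ (TyTrace _) _ |- _ => inversion H; clear H; subst
  | H : tykind _ (TyAll _ _) _ |- _ => inversion H; clear H; subst
  | H : tykind _ (TyRCons _ _ _) _ |- _ => inversion H; clear H; subst
  | H : tykind _ (TyT _) _ |- _ => inversion H; clear H; subst
  | H : tykind _ (if_row _) _ |- _ => unfold if_row in H; simpl in H
  | H : tykind _ (for_row _ _) _ |- _ => unfold for_row in H; simpl in H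
  | H : tykind _ (cell_row _) _ |- _ => unfold cell_row in H; simpl in H
  end.

(** The typing of [Rmap] mentions [C] only as a shifted constructor applied to the bound variable;
    its kind is recovered from there. *)
Lemma kinding_eta_inv (G : kctx) (C : con) (K1 K2 : kind) :
  kinding (K1 :: G) (CApp (cshift C) (CVar 0)) K2 -> kinding G C (KArr K1 K2).
Proof.
  intros H. inv_kinding. eapply kinding_cshift_inv.
  match goal with H : kinding _ (CVar 0) _ |- _ => inversion H; subst end.
  simpl in *.
  match goal with H : Some _ = Some _ |- _ => inversion H; subst end.
  eassumption.
Qed.

(** Reflexivity of type equality is available for well-kinded types only, so inversion up to
    conversion needs this fact. *)
Lemma has_type_tykind (G : kctx) (X : tctx) (M : tm) (A : ty) :
  has_type G X M A -> wf_ctx G X -> tykind G A KType.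
Proof.
  induction 1; intros HX;
    repeat match goal with
    | IH : wf_ctx ?G ?X -> _, HX : wf_ctx ?G ?X |- _ => specialize (IH HX)
    end; inv_tykind; auto using tykind_base, tykind_opplus_row, wf_ctx_cons;
    try (constructor; now auto using tykind_base, wf_ctx_cons, wf_ctx_tyshift).
  - eapply (proj1 (Forall_forall _ _) HX); eauto using nth_error_In.
  - eauto using tykind_inst.
  - repeat constructor.
  - repeat constructor; auto.
  - eauto using has_field_tykind.
  - repeat constructor. apply tykind_base_row.
  - constructor. constructor. constructor; [now apply kinding_eta_inv|].
    now inv_kinding.
  - eauto using tykind_inst.
  - repeat constructor.
  - repeat constructor.
  - now apply tyeq_tykind in H0.
Qed.

(** * Inversion of typing *)

(** Covers the formers whose typing has to be analysed when they sit in the active position of a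
    redex. [If], [Append] and [For] keep [T] itself, as conversion moves into their premises; the
    payloads of [TrOpEq] and [TrOpPlus] do not depend on [T]; the remaining formers fix [T] up to
    equality. *)
Definition typing_inversion (G : kctx) (X : tctx) (M : tm) (T : ty) : Prop :=
  match M with
  | Lam A M =>
      exists B, has_type G (A :: X) M B /\ tyeq G T (TyArr A B) KType
  | TLam K M =>
      exists A, has_type (K :: G) (map tyshift X) M A /\
        tyeq G T (TyAll K A) KType
  | If L M N =>
      has_type G X L TyBool /\ has_type G X M T /\ has_type G X N T
  | RCons l M N =>
      exists A R, has_type G X M A /\ has_type G X N (TyRecord R) /\
        tyeq G T (TyRecord (TyRCons l A R)) KType
  | Sing M => exists A, has_type G X M A /\ tyeq G T (TyList A) KType
  | Append M N => has_type G X M T /\ has_type G X N T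
  | For M N =>
      exists A, has_type G X M (TyList A) /\ has_type G (A :: X) N T
  | TrLit M => exists A, has_type G X M A /\ tyeq G T (TyTrace A) KType
  | TrIf M =>
      exists A, has_type G X M (TyRecord (if_row A)) /\
        tyeq G T (TyTrace A) KType
  | TrFor C M =>
      exists A, kinding G C KType /\ has_type G X M (TyRecord (for_row C A)) /\
        tyeq G T (TyTrace A) KType
  | TrCell M =>
      exists A, has_type G X M (TyRecord (cell_row A)) /\
        tyeq G T (TyTrace A) KType
  | TrOpEq C M => kinding G C KType /\ has_type G X M (TyRecord (opeq_row C))
  | TrOpPlus M => has_type G X M (TyRecord opplus_row)
  | _ => True
  end.

Lemma has_type_inversion (G : kctx) (X : tctx) (M : tm) (T : ty) :
  has_type G X M T -> wf_ctx G X -> typing_inversion G X M T.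
Proof.
  intros H HX. pose proof (has_type_tykind _ _ _ _ H HX) as HT.
  induction H; simpl in *; auto;
    try (repeat first [split | eexists]; eauto using te_refl, has_type; fail).
  (* Conversion: the induction hypothesis concerns the type before conversion, and the equality is
     either composed with the one found there or pushed into the subterms. *)
  specialize (IHhas_type HX). pose proof (tyeq_tykind _ _ _ _ H0) as [_ HB].
  specialize (IHhas_type HB).
  destruct M; simpl in *; auto;
    repeat match goal with
    | H : _ /\ _ |- _ => destruct H
    | H : exists _, _ |- _ => destruct H
    end; repeat first [split | eexists]; eauto using te_trans, t_conv.
Qed.

(** [lookup] and [has_field] both select the leftmost occurrence of a label, and equal rows agree on
    labels cell by cell, so the two searches proceed in step. *)
Lemma has_type_lookup (G : kctx) (X : tctx) (fs : list (label * tm)) :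
  forall l A M R, wf_ctx G X -> has_type G X (record_tm fs) (TyRecord R) ->
    has_field l A R -> lookup l fs = Some M -> has_type G X M A.
Proof.
  induction fs as [|[l' N] fs IH]; intros l A M R HX HR HA HM;
    [discriminate|].
  apply has_type_inversion in HR as (B & R' & HN & HF & E); auto.
  apply tyeq_components in E; [|exact I|exact I].
  simpl in HM. destruct HA as [R|l'' B' R Hl HA]; apply tyeq_components in E;
    try exact I; simpl in E; destruct E as (<- & EA & ER).
  - rewrite String.eqb_refl in HM. inversion HM; subst.
    eapply t_conv; eauto.
  - apply String.eqb_neq in Hl. rewrite Hl in HM. apply IH with l R; auto.
    eapply t_conv; eauto using te_record.
Qed.

(** * Records over explicit rows: the contracta of rmap and rfold *)

Definition map_fields {T U : Type} (f : label * T -> U)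
    (fs : list (label * T)) : list (label * U) :=
  map (fun p => (fst p, f p)) fs.

Lemma kinding_row_con (G : kctx) (fs : list (label * con)) :
  kinding G (row_con fs) KRow ->
  forall f, In f fs -> kinding G (snd f) KType.
Proof.
  induction fs as [|[l D] fs IH]; simpl; intros H f []; inv_kinding;
    subst; auto.
Qed.

Lemma tyeq_row_con (G : kctx) (fs : list (label * con)) :
  kinding G (row_con fs) KRow ->
  tyeq G (TyT (row_con fs)) (row_ty (map_fields (fun f => TyT (snd f)) fs)) KRow.
Proof.
  induction fs as [|[l D] fs IH]; simpl; intros H; [apply te_Trnil|].
  inv_kinding. eapply te_trans; [now apply te_Trcons|].
  apply te_rcons; auto. apply te_refl. now constructor.
Qed.

Lemma tyeq_rmap_row_con (G : kctx) (C : con) (fs : list (label * con)) :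
  kinding G C (KArr KType KType) -> kinding G (row_con fs) KRow ->
  tyeq G (TyT (CRmap C (row_con fs)))
    (row_ty (map_fields (fun f => TyT (CApp C (snd f))) fs)) KRow.
Proof.
  intros HC. induction fs as [|[l D] fs IH]; simpl; intros H.
  - eapply te_trans; [|apply te_Trnil].
    apply te_Trow, ce_red; try constructor; auto.
  - inv_kinding. assert (kinding G (CApp C D) KType) by eauto using k_app.
    eapply te_trans;
      [apply te_Trow, ce_red; [| |apply cr_rmap_cons]; repeat constructor; auto|].
    eapply te_trans; [apply te_Trcons; auto; now constructor|].
    apply te_rcons; auto. apply te_refl. now constructor.
Qed.

Lemma tyeq_row_ty (G : kctx) (T : Type) (f g : label * T -> ty)
    (fs : list (label * T)) :
  (forall p, In p fs -> tyeq G (f p) (g p) KType) ->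
  tyeq G (row_ty (map_fields f fs)) (row_ty (map_fields g fs)) KRow.
Proof.
  induction fs as [|p fs IH]; simpl; intros H.
  - apply te_refl. constructor.
  - apply te_rcons; auto.
Qed.

Lemma has_type_record_tm (G : kctx) (X : tctx) (T : Type) (t : label * T -> tm)
    (f : label * T -> ty) (fs : list (label * T)) :
  (forall p, In p fs -> has_type G X (t p) (f p)) ->
  has_type G X (record_tm (map_fields t fs)) (TyRecord (row_ty (map_fields f fs))).
Proof.
  induction fs as [|p fs IH]; simpl; intros H; constructor; auto.
Qed.

(** Distinct labels guarantee that the leftmost field with the label of [p] is the entry [p] itself,
    so that it has the type [f p]. *)
Lemma has_field_row_ty (T : Type) (f : label * T -> ty) (fs : list (label * T))
    (p : label * T) :
  NoDup (map fst fs) -> In p fs ->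
  has_field (fst p) (f p) (row_ty (map_fields f fs)).
Proof.
  induction fs as [|q fs IH]; simpl; intros HN HI; [contradiction|].
  inversion HN; subst. destruct HI as [->|HI]; [constructor|].
  constructor; auto. intros E. apply in_map with (f := fst) in HI. congruence.
Qed.

(** When all fields share one type, the leftmost occurrence of a label has this type whichever entry
    it comes from; repeated labels do no harm. *)
Lemma has_field_row_ty_const (T : Type) (A : ty) (fs : list (label * T))
    (p : label * T) :
  In p fs -> has_field (fst p) A (row_ty (map_fields (fun _ => A) fs)).
Proof.
  induction fs as [|q fs IH]; simpl; intros HI; [contradiction|].
  destruct (String.eqb_spec (fst p) (fst q)) as [->|E]; [constructor|].
  constructor; auto. destruct HI as [->|HI]; [congruence|auto].
Qed.

Lemma has_type_rmap_contractum (G : kctx) (X : tctx) (fs : list (label * con))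
    (C : con) (M N : tm) :
  wf_ctx G X -> NoDup (map fst fs) ->
  has_type G X M
    (TyAll KType (TyArr (TyT (CVar 0)) (TyT (CApp (cshift C) (CVar 0))))) ->
  has_type G X N (TyT (CRecord (row_con fs))) ->
  has_type G X
    (record_tm (map_fields (fun f => App (TApp M (snd f)) (Proj N (fst f))) fs))
    (TyT (CRecord (CRmap C (row_con fs)))).
Proof.
  intros HX HD HM HN.
  assert (HC : kinding G C (KArr KType KType)).
  { apply has_type_tykind in HM; auto. inv_tykind. now apply kinding_eta_inv. }
  assert (HR : kinding G (row_con fs) KRow).
  { apply has_type_tykind in HN; auto. inv_tykind. now inv_kinding. }
  eapply t_conv.
  - apply has_type_record_tm with (f := fun f => TyT (CApp C (snd f))).
    intros [l D] HI. pose proof (kinding_row_con _ _ HR _ HI) as HK.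
    simpl in *. apply t_app with (TyT D).
    (* Instantiation at [D] cancels the shift of [C], leaving a function from [TyT D] to
       [TyT (CApp C D)]. *)
    + apply (t_tapp _ _ _ _ _ D) in HM; auto. unfold ty_inst in HM.
      cbn [tysubst csubst scons] in HM. now rewrite csubst_scons_cshift in HM.
    + eapply t_proj;
        [|exact (has_field_row_ty _ (fun f => TyT (snd f)) _ _ HD HI)].
      eapply t_conv; [exact HN|]. apply te_sym.
      eapply te_trans; [now apply te_Trecord|].
      now apply te_record, tyeq_row_con.
  - eapply te_trans; [apply te_Trecord; now constructor|].
    now apply te_record, tyeq_rmap_row_con.
Qed.

Lemma has_type_rfold_contractum (G : kctx) (X : tctx) (fs : list (label * con))
    (C : con) (L M N : tm) :
  wf_ctx G X ->
  has_type G X L (TyArr (TyT C) (TyArr (TyT C) (TyT C))) ->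
  has_type G X M (TyT C) ->
  has_type G X N (TyT (CRecord (CRmap (CLam KType (cshift C)) (row_con fs)))) ->
  has_type G X
    (fold_right (fun f P => App (App L (Proj N (fst f))) P) M fs) (TyT C).
Proof.
  intros HX HL HM HN.
  assert (HC : kinding G C KType).
  { apply has_type_tykind in HM; auto. now inv_tykind. }
  assert (HF : kinding G (CLam KType (cshift C)) (KArr KType KType)).
  { constructor. now apply kinding_cshift. }
  assert (HR : kinding G (row_con fs) KRow).
  { apply has_type_tykind in HN; auto. inv_tykind. now inv_kinding. }
  assert (HN' : has_type G X N
                  (TyRecord (row_ty (map_fields (fun _ => TyT C) fs)))).
  { eapply t_conv; [exact HN|]. apply te_sym.
    eapply te_trans; [apply te_Trecord; now constructor|]. apply te_record.
    eapply te_trans; [now apply tyeq_rmap_row_con|].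
    (* Every field of the mapped row is a constant function applied to a constructor, one beta step
       away from [C]. *)
    apply tyeq_row_ty. intros f HI. apply te_T, ce_red; auto.
    - eapply k_app; eauto using kinding_row_con.
    - rewrite <- (csubst_scons_cshift C (snd f)) at 2. constructor. }
  assert (HI : forall f, In f fs -> has_type G X (Proj N (fst f)) (TyT C)).
  { intros f Hf. eapply t_proj; eauto using has_field_row_ty_const. }
  (* The record [N] keeps its whole row while the fold recurses on the tail of the list, so the
     induction retains only the typing of the projections. *)
  clear HN HN' HR. induction fs as [|f fs IH]; simpl; auto.
  eapply t_app; [eapply t_app|]; eauto using in_eq, in_cons.
Qed.

(** * Payload rows of traces under equality *)

Lemma tyeq_if_row (G : kctx) (A B : ty) :
  tyeq G A B KType ->
  tyeq G (TyRecord (if_row A)) (TyRecord (if_row B)) KType.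
Proof.
  intros H. repeat (apply te_record || apply te_rcons || apply te_trace); auto;
    apply te_refl; repeat constructor.
Qed.

Lemma tyeq_TRACE (G : kctx) (C D : con) :
  ceq G C D KType -> tyeq G (TyT (CApp TRACE C)) (TyT (CApp TRACE D)) KType.
Proof. eauto using te_T, ce_app, ce_refl, kinding_TRACE. Qed.

Lemma tyeq_for_row (G : kctx) (C D : con) (A B : ty) :
  ceq G C D KType -> tyeq G A B KType ->
  tyeq G (TyRecord (for_row C A)) (TyRecord (for_row D B)) KType.
Proof.
  intros H H'. apply te_record, te_rcons; [now apply tyeq_TRACE|].
  apply te_rcons; [now apply te_trace|]. apply te_refl. constructor.
Qed.

Lemma tyeq_cell_row (G : kctx) (A B : ty) :
  tyeq G A B KType ->
  tyeq G (TyRecord (cell_row A)) (TyRecord (cell_row B)) KType.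
Proof.
  intros H. repeat (apply te_record || apply te_rcons); auto;
    apply te_refl; repeat constructor.
Qed.

Lemma tyeq_opeq_row (G : kctx) (C D : con) :
  ceq G C D KType ->
  tyeq G (TyRecord (opeq_row C)) (TyRecord (opeq_row D)) KType.
Proof.
  intros H. apply te_record.
  repeat (apply te_rcons; [now apply tyeq_TRACE|]). apply te_refl. constructor.
Qed.

(** * Preservation *)

Lemma cred_ceq (G : kctx) (C D : con) (K : kind) :
  kinding G C K -> cred C D -> ceq G C D K.
Proof. eauto using ce_red, kinding_cred. Qed.

Lemma has_type_conv_sym (G : kctx) (X : tctx) (M : tm) (A B : ty) :
  has_type G X M A -> tyeq G A B KType -> has_type G X M B.
Proof. eauto using t_conv, te_sym. Qed.

Ltac invert_typing H HX :=
  apply has_type_inversion in H; [simpl in H|exact HX];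
  repeat match type of H with
  | exists _, _ => let x := fresh in destruct H as [x H]
  end.

Ltac components E :=
  apply tyeq_components in E; [simpl in E|exact I|exact I].

Lemma has_type_elem_tykind (G : kctx) (X : tctx) (M : tm) (A : ty) :
  wf_ctx G X -> has_type G X M (TyList A) -> tykind G A KType.
Proof. intros HX H. apply has_type_tykind in H; auto. now inversion H. Qed.

Lemma has_type_payload_tykind (G : kctx) (X : tctx) (M : tm) (A : ty) :
  wf_ctx G X -> has_type G X M (TyTrace A) -> tykind G A KType.
Proof. intros HX H. apply has_type_tykind in H; auto. now inversion H. Qed.

(** For the branches of [Typecase]: [C] is the pattern, [D] the component of the scrutinee, and the
    two instantiations compose to the one at the scrutinee itself. *)
Lemma has_type_cinst_under (G : kctx) (X : tctx) (M : tm) (B : ty) (C D : con)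
    (K : kind) :
  has_type (K :: G) (map tyshift X) M (ty_inst_under C B) -> kinding G D K ->
  has_type G X (tm_cinst D M) (ty_inst (csubst (scons D CVar) C) B).
Proof.
  intros HM HD. rewrite <- ty_inst_inst_under. eauto using has_type_cinst.
Qed.

(** Induction is on the typing rather than on the step: each typing rule then meets only the steps
    of its own term former, and conversion follows from its induction hypothesis. *)
Lemma preservation (G : kctx) (X : tctx) (M : tm) (A : ty)
    (H : has_type G X M A) :
  forall M', wf_ctx G X -> step M M' -> has_type G X M' A.
Proof.
  induction H; intros M0 HX HS; inversion HS; subst;
    (* Most congruence steps leave the type alone. For [Tracecase] the induction hypotheses also ask
       that the payload types added to the context be well kinded. *)
    try solve
      [econstructor; eauto 4 using wf_ctx_cons, wf_ctx_tyshift
      |eapply t_tracecase;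
       eauto 8 using wf_ctx_cons, wf_ctx_tyshift, tykind_if_row, tykind_for_row,
         tykind_cell_row, tykind_opeq_row, tykind_opplus_row, tykind_tyshift,
         has_type_payload_tykind, k_var].
  - invert_typing H HX. destruct H as [H E]. components E.
    destruct E as [EA EB]. eapply t_conv; [|exact EB].
    eapply has_type_inst; eauto using has_type_conv_sym.
  - invert_typing H HX. destruct H as (? & ? & ?).
    econstructor; eauto using t_app.
  - invert_typing H HX. destruct H as [H E]. components E. destruct E as [<- E].
    eapply has_type_cinst; eauto using has_type_conv_sym.
    eapply t_conv; eauto.
  - invert_typing H HX. destruct H as (? & ? & ?).
    econstructor; eauto using t_tapp.
  (* Reducing the constructor argument changes the instantiated type itself; conversion along the
     reduction takes it back. *)
  - pose proof (has_type_tykind _ _ _ _ H HX) as HK. inversion HK; subst.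
    eapply t_conv; [eapply t_tapp; eauto using kinding_cred|].
    eapply tyeq_inst; eauto using cred_ceq.
  - eapply has_type_inst; eauto. now constructor.
  - assumption.
  - assumption.
  - invert_typing H HX. destruct H as (? & ? & ?).
    auto using t_if.
  - eapply has_type_lookup; eauto.
  - invert_typing H HX. destruct H as (? & ? & ?).
    econstructor; eauto using t_proj.
  (* [Nil] needs a kind for its element type, which regularity of the loop body supplies in the
     extended context. *)
  - pose proof (has_type_elem_tykind _ _ _ _ HX H) as HA. constructor.
    eapply has_type_elem_tykind; [|exact H0]. now apply wf_ctx_cons.
  - invert_typing H HX. destruct H as [H E]. components E.
    eapply has_type_inst; eauto using t_conv.
  - invert_typing H HX. destruct H as [? ?]. constructor; eauto using t_for.
  - invert_typing H HX. destruct H as [? ?]. econstructor; eauto.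
    (* [N] moves below the binder of the outer loop and is weakened just above its own variable.
       Constructor variables stay put, so its type is renamed by the identity. *)
    eapply t_for; eauto. rewrite <- (tyren_id (TyList B)).
    eapply has_type_ren; eauto.
    + intros n K Hn. exact Hn.
    + intros [|n] C Hn; simpl in *; now rewrite tyren_id.
  - invert_typing H HX. destruct H as (? & ? & ?).
    constructor; eauto using t_for.
  - pose proof (has_type_elem_tykind _ _ _ _ HX H) as HA.
    econstructor; eauto using wf_ctx_cons.
  - now apply has_type_rmap_contractum.
  - pose proof (has_type_tykind _ _ _ _ (t_rmap _ _ _ _ _ _ H H0) HX) as HK.
    inv_tykind. inv_kinding.
    (* The row occurs both in the type of [N] and in the result: one conversion goes to the reduct,
       the other comes back from it. *)
    eapply t_conv; [eapply t_rmap; [exact H|]|].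
    + eapply has_type_conv_sym; eauto.
      apply te_T, ce_record. eauto using cred_ceq.
    + apply te_T, ce_record, ce_rmap; eauto using ce_refl, cred_ceq.
  - now apply has_type_rfold_contractum.
  - pose proof (has_type_tykind _ _ _ _ H1 HX) as HK.
    inversion HK; subst.
    match goal with H : kinding _ (CRecord _) _ |- _ => inversion H; subst end.
    match goal with H : kinding _ (CRmap _ _) _ |- _ => inversion H; subst end.
    eapply t_rfold; eauto. eapply has_type_conv_sym; eauto.
    apply te_T, ce_record, ce_rmap; eauto using ce_refl, cred_ceq.
  - assumption.
  - assumption.
  - assumption.
  - inversion H; subst.
    eapply (has_type_cinst_under _ _ _ _ (CList (CVar 0))); eauto.
  - inversion H; subst.
    eapply (has_type_cinst_under _ _ _ _ (CRecord (CVar 0))); eauto.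
  - inversion H; subst.
    eapply (has_type_cinst_under _ _ _ _ (CTrace (CVar 0))); eauto.
  - eapply t_conv; [eapply t_typecase; eauto using kinding_cred|].
    eapply tyeq_inst; eauto using cred_ceq.
  (* [TrLit] is typed on constants only, and these do not reduce. *)
  - match goal with H : step (Const _) _ |- _ => inversion H end.
  - pose proof (has_type_payload_tykind _ _ _ _ HX (t_trfor _ _ _ _ _ H H0)) as HA.
    constructor; eauto using kinding_cred.
    eapply has_type_conv_sym; eauto using tyeq_for_row, cred_ceq, te_refl.
  - constructor; eauto using kinding_cred.
    eapply has_type_conv_sym; eauto using tyeq_opeq_row, cred_ceq.
  - invert_typing H HX. destruct H as [H E]. components E.
    eapply has_type_inst; eauto using t_conv.
  - invert_typing H HX. destruct H as [H E]. components E.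
    eapply has_type_inst; eauto using t_conv, tyeq_if_row.
  - invert_typing H HX. destruct H as (HC & H & E). components E.
    eapply has_type_inst2; eauto.
    (* Exposes the instantiated payload type, in which the substitution for the hidden constructor
       variable cancels the weakening of the trace's type. *)
    change (has_type G X M1
              (TyRecord (for_row C (tysubst (scons C CVar) (tyshift A))))).
    rewrite tysubst_scons_tyshift, tysubst_id by reflexivity.
    eapply t_conv; eauto using tyeq_for_row, ce_refl.
  - invert_typing H HX. destruct H as [H E]. components E.
    eapply has_type_inst; eauto using t_conv, tyeq_cell_row.
  - invert_typing H HX. destruct H as [HC H].
    eapply has_type_inst2; eauto.
  - invert_typing H HX. eapply has_type_inst; eauto.
  - invert_typing H HX. destruct H as (? & ? & ?).
    econstructor; eauto using t_tracecase.
Qed.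

Theorem lemma14 (G : kctx) (X : tctx) (M M' : tm) (A : ty) :
  wf_ctx G X -> has_type G X M A -> step M M' -> has_type G X M' A.
Proof. eauto using preservation. Qed.
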